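(* Let $p$ and $l$ be odd rational primes such that the multiplicative order $f = \mathrm{ord}\,p \pmod{l}$ of $p$ modulo $l$ is defined and even. Let $s \geq 1$ be an integer and let $q = p^{\alpha}$ with $\alpha = fs$, so that $q \equiv 1 \pmod{2l}$. Let $a,b,c \in \mathbf{F}_q$ with $abc \neq 0$, and let $C$ be the (non-singular) projective plane curve $aY^{2l} = bX^{2l} + cZ^{2l}$ over $\mathbf{F}_q$. Fix a generator $\gamma$ of $\mathbf{F}_q^*$ and let $i,j$ be integers with $\mathrm{ind}_{\gamma}(b/c) \equiv i \pmod{2l}$ and $\mathrm{ind}_{\gamma}(a/c) \equiv j \pmod{2l}$. Let $\theta = (-1)^s q^{1/2}$ and let $\zeta$ be any primitive complex $l$-th root of unity. Then the zeta function $Z(t,C)$ of $C/\mathbf{F}_q$ is a rational function in $t$ of the form $$Z(t,C) = \frac{P(t)}{(1-t)(1-qt)},$$ where the polynomial $P(t)$ is given as follows. 1. If $i \equiv j \equiv 0 \pmod{2l}$, then $P(t) = (1- \theta t)^{(2l-1)(2l-2)}$. 2. If $i,j \equiv 0 \pmod 2$ and $i,\ j,\ i-j \not\equiv 0 \pmod{2l}$, then $$P(t) = (1 - \theta t)^{4l-4} \prod_{r=1}^{l-1} (1 - \zeta^r \theta t)^{4l-6}.$$ 3. If $i, j \equiv 0 \pmod 2$ and one of the following holds: (i) $i \equiv 0,\ j \not\equiv 0 \pmod{2l}$; (ii) $i \not\equiv 0,\ j \equiv 0 \pmod{2l}$; (iii) $i,j \not\equiv 0,\ i \equiv j \pmod{2l}$;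 then $$P(t) = (1 - \theta t)^{2l-2} \prod_{r=1}^{l-1}(1 - \zeta^r \theta t)^{4l-4}.$$ 4. If one of the following holds: (i) $i \equiv 0,\ j \equiv l \pmod{2l}$; (ii) $i \equiv l,\ j \equiv 0 \pmod{2l}$; (iii) $i \equiv j \equiv l \pmod{2l}$; then $$P(t) = (1 - \theta t)^{2(l-1)^2} (1 + \theta t)^{2l(l-1)}.$$ 5. If one of the following holds: (i) $j \not\equiv 0 \pmod 2$, $i \equiv 0,\ j \not\equiv l \pmod{2l}$; (ii) $i \not\equiv 0 \pmod 2$, $i \not\equiv l,\ j \equiv 0 \pmod{2l}$; (iii) $i \not\equiv 0 \pmod 2$, $i \equiv j,\ i \not\equiv l \pmod{2l}$; then $$P(t) = (1 + \theta t)^{2l-2} \prod_{r=1}^{l-1}\bigl((1 - \zeta^r \theta t)(1 + \zeta^r \theta t)\bigr)^{2l-2} = \prod_{r=1}^{2l-1}(1 - \xi^r \theta t)^{2l-2},$$ where $\xi$ is a primitive complex $2l$-th root of unity. 6. If $i,\ j,\ i-j \not\equiv 0, l \pmod{2l}$ and one of the following holds: (i) $i \not\equiv j \pmod 2$; (ii) $i,j \not\equiv 0 \pmod 2$; then $$P(t) = \bigl((1 - \theta t)(1 + \theta t)\bigr)^{2l-2} \prod_{r=1}^{l-1}\bigl((1 - \zeta^r \theta t)^{2l-4} (1 + \zeta^r \theta t)^{2l-2}\bigr).$$ 7. If one of the following holds: (i) $i \equiv l,\ j \not\equiv 0,l \pmod{2l}$; (ii) $i \not\equiv 0,l,\ j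 \equiv l \pmod{2l}$; (iii) $i,j \not\equiv 0,l,\ i-j \equiv l \pmod{2l}$; then $$P(t) = \bigl((1 - \theta t)(1 + \theta t)\bigr)^{l-1} \prod_{r=1}^{l-1}\bigl((1 - \zeta^r \theta t)^{2l-3} (1 + \zeta^r \theta t)^{2l-1}\bigr).$$
   Context: For coprime $p$ and $l$, $\mathrm{ord}\,p\pmod l$ is the least positive integer $f$ with $p^f \equiv 1 \pmod l$. For a generator $\gamma$ of $\mathbf{F}_q^*$ and $x \in \mathbf{F}_q^*$, $\mathrm{ind}_\gamma(x)$ denotes an integer $k$ (well defined modulo $q-1$) with $\gamma^k = x$. Here $q^{1/2} = p^{fs/2}$ is the positive square root of $q$, an integer since $f$ is even. A condition such as ''$x \not\equiv 0,l \pmod{2l}$'' means $x\not\equiv 0$ and $x \not\equiv l \pmod{2l}$. For a non-singular projective curve $C$ over $\mathbf{F}_q$, with $a(n,C)$ denoting the number of $\mathbf{F}_{q^n}$-rational points of $C$ ($n\ge 1$), the zeta function is $$Z(t,C) = \exp\left(\sum_{n=1}^{\infty} \frac{a(n,C)\,t^n}{n}\right).$$ *)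

(* Defs.v *)
From HB Require Import structures.
From mathcomp Require Export all_boot all_order all_algebra.
From mathcomp Require Export all_fingroup all_solvable all_field.
From mathcomp.multinomials Require Export mpoly.

Set Implicit Arguments.
Unset Strict Implicit.
Unset Printing Implicit Defensive.

Import GRing.Theory Num.Theory.
Local Open Scope ring_scope.

Definition is_ord (p l f : nat) : Prop :=
  [/\ (0 < f)%N, p ^ f = 1 %[mod l]
    & forall k : nat, (0 < k)%N -> p ^ k = 1 %[mod l] -> (f <= k)%N].

(* [is_ind gamma x k]: the integer k is a value of ind_gamma(x). *)
Definition is_ind (F : finFieldType) (gamma : {unit F}) (x : F) (k : int) :
  Prop := FinRing.uval gamma ^ k = x.

(* A formal power series is represented by its sequence of coefficients. *)
Section FormalPowerSeries.
Variable K : fieldType.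

Definition fps_mul (A B : nat -> K) : nat -> K :=
  fun n => \sum_(i < n.+1) A i * B (n - i)%N.

(* exp(A) = \sum_k A^k / k! for a series A with A 0 = 0.  As A is divisible by *)
(* t, the coefficient of t^n only involves k <= n and A modulo t^(n+1).        *)
Definition fps_exp (A : nat -> K) : nat -> K :=
  fun n => (\sum_(k < n.+1) (k`!%:R)^-1 *: (\poly_(i < n.+1) A i) ^+ k)`_n.

(* The denominator is meant to have an invertible constant coefficient.        *)
Definition fps_is_fraction (A : nat -> K) (P Q : {poly K}) : Prop :=
  fps_mul A (fun n => Q`_n) =1 (fun n => P`_n).

End FormalPowerSeries.

Section PlaneCurve.
Variable F : finFieldType.

(* The point of P^2(L) with homogeneous coordinates v != 0 is the set of the   *)
(* nonzero multiples of v.                                                     *)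
Definition proj_point (L : finFieldType) (v : 'rV[L]_3) : {set 'rV[L]_3} :=
  [set c *: v | c : L & c != 0].

(* For g homogeneous; [finvect_type L] is L with its finite type structure.    *)
Definition curve_points (g : {mpoly F[3]}) (L : fieldExtType F) :
    {set {set 'rV[finvect_type L]_3}} :=
  [set proj_point v | v : 'rV[finvect_type L]_3
     & (v != 0) && ((map_mpoly (in_alg (finvect_type L)) g).@[fun k => v 0 k] == 0)].

(* Z(t, C) for the curve C : g = 0, where E n is the extension of F of degree  *)
(* n, for n >= 1.                                                              *)
Definition zeta (g : {mpoly F[3]}) (E : nat -> fieldExtType F) : nat -> algC :=
  fps_exp (fun n => if n is 0%N then 0 else #|curve_points g (E n)|%:R / n%:R).

(* a Y^m = b X^m + c Z^m, in the homogeneous coordinates X, Y, Z of indices    *)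
(* 0, 1, 2.                                                                    *)
Definition diag_curve (m : nat) (a b c : F) : {mpoly F[3]} :=
  let X : {mpoly F[3]} := 'X_(inord 0) in
  let Y : {mpoly F[3]} := 'X_(inord 1) in
  let Z : {mpoly F[3]} := 'X_(inord 2) in
  a *: Y ^+ m - (b *: X ^+ m + c *: Z ^+ m).

End PlaneCurve.

(* Main.v *)
Require Import Defs.
From mathcomp Require Import ring zify.

Set Implicit Arguments.
Unset Strict Implicit.
Unset Printing Implicit Defensive.

Import Order.TTheory GRing.Theory Num.Theory.
Local Open Scope ring_scope.

(** Put m = 2l.  Over a field K with |K| elements, m dividing |K| - 1, let chi
    be a multiplicative character of order m.  Counting m-th roots with chi, as
    Weil does, turns the number of points of a Y^m = b X^m + c Z^m over K into
      |K| + 1 + sum_(u, v) chi(c/a)^u chi(c/b)^v J(u, v),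
    where u, v and u + v are nonzero mod m and J(u, v) is the Jacobi sum
    sum_w chi(w)^u chi(1 - w)^v ([card_proj_diag_pair_sum]).

    The parity of f = ord p mod l makes all these Jacobi sums equal
    ([jac_semiprimitive]).  Indeed p^(f/2) = -1 mod m, so the substitution
    w |-> w^(p^(f/2)), which is a field automorphism, shows that J is equal to
    its own conjugate; as J times its conjugate is |K| = r^2, with
    r = p^(f s n / 2) for K of degree n over F, J is r or -r.  Being rational, J
    is also fixed by the Galois automorphisms xi |-> xi^k, k prime to m, so
    J(ku, kv) = J(u, v) for the l - 1 odd k < 2l other than l.  Summing over all
    odd k < 2l leaves a multiple of l, because the sum of xi^(kx) over these k
    is 0 or l or -l; and J(lu, lv), in which chi^l has order 2, is degenerate and
    is -1 mod l.  Hence J = -1 mod l, whereas r = (-1)^(sn) mod l, so that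
    J = -(-1)^(sn) r, which is -theta^n.

    The number of points over the extension of degree n is therefore
    q^n + 1 - theta^n sum_(u, v) (xi^(uj + vi))^n, up to the sign of i and j, and
    Z(t, C) is the quotient of prod_(u, v) (1 - xi^(uj + vi) theta t)
    ([jacobi_poly]) by (1 - t) (1 - q t).  Since a polynomial with constant
    coefficient 1 is determined by the power sums of its inverse roots
    ([has_logder_eq]), each of the seven shapes is obtained by comparing power
    sums.  The one of [jacobi_poly] is theta^n times
      m^2 [m | ni and m | nj] - m ([m | ni] + [m | nj] + [m | n(i - j)]) + 2,
    which only depends on whether 2 and l divide n, i, j and i - j. *)

(** * Power series with a given logarithmic derivative *)

Section LogarithmicDerivative.
Variable K : numFieldType.
Implicit Types (P Q : {poly K}) (u v : nat -> K) (N : nat).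

Definition gen_upto u N : {poly K} := \poly_(k < N) u k.+1.

(** Modulo 'X^(N+1), P is exp (sum_n u_n 'X^n / n): P' / P = sum_n u_(n+1) 'X^n
    and P has constant coefficient 1.  The truncation at N keeps everything inside polynomials.  If P
    is the product of the 1 - w 'X, then - u_n is the sum of the w^n. *)
Definition has_logder N P u := ('X^N %| P^`() - gen_upto u N * P) && (P`_0 == 1).

Lemma has_logder_ext N P u v :
  (forall n, (0 < n)%N -> u n = v n) -> has_logder N P u -> has_logder N P v.
Proof.
move=> uv; rewrite /has_logder; suff -> : gen_upto u N = gen_upto v N by [].
by apply/polyP=> k; rewrite !coef_poly uv.
Qed.

Lemma has_logder1 N : has_logder N 1 (fun=> 0).
Proof.
rewrite /has_logder coef1 eqxx andbT -polyC1 derivC sub0r.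
suff -> : gen_upto (fun=> 0) N = 0 by rewrite mul0r oppr0 dvdp0.
by apply/polyP=> k; rewrite coef_poly coef0 if_same.
Qed.

(** (PQ)' / PQ = P' / P + Q' / Q. *)
Lemma has_logderM N P Q u v :
  has_logder N P u -> has_logder N Q v ->
  has_logder N (P * Q) (fun n => u n + v n).
Proof.
move=> /andP[dP /eqP P0] /andP[dQ /eqP Q0]; apply/andP; split; last first.
  by rewrite coef0M P0 Q0 mulr1.
have -> : gen_upto (fun n => u n + v n) N = gen_upto u N + gen_upto v N.
  by apply/polyP=> k; rewrite coefD !coef_poly; case: ifP; rewrite ?addr0.
have -> : (P * Q)^`() - (gen_upto u N + gen_upto v N) * (P * Q) =
  (P^`() - gen_upto u N * P) * Q + (Q^`() - gen_upto v N * Q) * P.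
  by rewrite derivM; ring.
by rewrite dvdp_add // dvdp_mulr.
Qed.

Lemma has_logderX N P u e :
  has_logder N P u -> has_logder N (P ^+ e) (fun n => e%:R * u n).
Proof.
move=> dP; elim: e => [|e IH].
  by rewrite expr0; apply: has_logder_ext (has_logder1 N) => n _; rewrite mul0r.
rewrite exprS; apply: has_logder_ext (has_logderM dP IH) => n _ /=.
by rewrite mulrSr; ring.
Qed.

Lemma has_logder_prod N (I : Type) (r : seq I) (S : pred I)
    (P : I -> {poly K}) (u : I -> nat -> K) :
  (forall i, S i -> has_logder N (P i) (u i)) ->
  has_logder N (\prod_(i <- r | S i) P i) (fun n => \sum_(i <- r | S i) u i n).
Proof.
move=> dP; elim: r => [|i r IH].
  rewrite big_nil; apply: has_logder_ext (has_logder1 N) => n _.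
  by rewrite big_nil.
rewrite big_cons; case Si: (S i); last first.
  by apply: has_logder_ext IH => n _; rewrite big_cons Si.
by apply: has_logder_ext (has_logderM (dP i Si) IH) => n _; rewrite big_cons Si.
Qed.

(** The logarithmic derivative is a geometric series of ratio w 'X. *)
Lemma has_logder_linear N (w : K) :
  has_logder N (1 - w *: 'X) (fun n => - w ^+ n).
Proof.
apply/andP; split; last by rewrite coefB coef1 coefZ coefX mulr0 subr0.
have -> : gen_upto (fun n => - w ^+ n) N =
    - (w%:P * \sum_(k < N) (w *: 'X) ^+ k).
  rewrite /gen_upto poly_def mulr_sumr -sumrN; apply: eq_bigr => k _.
  by rewrite exprZn exprS -!mul_polyC polyCN polyCM; ring.
have H := subrX1 (w *: 'X : {poly K}) N.
have -> : (1 - w *: 'X)^`() = - w%:P :> {poly K}.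
  by rewrite derivB derivZ derivX -polyC1 derivC sub0r -mul_polyC mulr1.
have -> : - w%:P - - (w%:P * \sum_(k < N) (w *: 'X) ^+ k) * (1 - w *: 'X) =
  - (w%:P * (w *: 'X) ^+ N) :> {poly K}.
  have -> : (w *: 'X) ^+ N = 1 + (w *: 'X - 1) * \sum_(i < N) (w *: 'X) ^+ i
    :> {poly K} by rewrite -H; ring.
  ring.
by rewrite dvdpNr dvdp_mull // exprZn -mul_polyC dvdp_mull.
Qed.

Lemma dvd_polyXn_coef N P : reflect (forall i, (i < N)%N -> P`_i = 0) ('X^N %| P).
Proof.
apply: (iffP idP) => [/dvdpP[Q ->] i ltiN | P0]; first by rewrite coefMXn ltiN.
suff -> : P = drop_poly N P * 'X^N by rewrite dvdp_mulIr.
apply/polyP=> i; rewrite coefMXn coef_drop_poly; case: ltnP => [/P0 //|leNi].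
by rewrite subnK.
Qed.

(** In characteristic 0, comparing coefficients in P' = (sum_n u_(n+1) 'X^n) P
    gives a recurrence that determines P from its constant coefficient. *)
Lemma has_logder_coefS N P u n :
  has_logder N P u -> (n < N)%N ->
  P`_n.+1 *+ n.+1 = \sum_(k < n.+1) u k.+1 * P`_(n - k).
Proof.
move=> /andP[/dvd_polyXn_coef/(_ n) dP _] ltnN; move: (dP ltnN) => /eqP.
rewrite coefB coef_deriv subr_eq0 => /eqP->; rewrite coefM.
apply: eq_bigr => k _; rewrite coef_poly.
by rewrite (leq_ltn_trans _ ltnN) // -ltnS.
Qed.

Lemma has_logder_leq N M P u : (N <= M)%N -> has_logder M P u -> has_logder N P u.
Proof.
move=> leNM dP; have P0 : P`_0 == 1 by case/andP: dP.
apply/andP; split=> //; apply/dvd_polyXn_coef => n ltnN.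
rewrite coefB coef_deriv (has_logder_coefS dP (leq_trans ltnN leNM)) coefM.
apply/eqP; rewrite subr_eq0; apply/eqP/eq_bigr => k _.
by rewrite coef_poly (leq_ltn_trans _ ltnN) // -ltnS.
Qed.

Lemma has_logder_uniq N P Q u i :
  has_logder N P u -> has_logder N Q u -> (i <= N)%N -> P`_i = Q`_i.
Proof.
move=> dP dQ; elim/ltn_ind: i => -[_ _|i IH ltiN].
  by have [[_ /eqP->] [_ /eqP->]] := (andP dP, andP dQ).
suff /eqP : P`_i.+1 *+ i.+1 = Q`_i.+1 *+ i.+1 by rewrite eqrMn2r => /eqP.
rewrite (has_logder_coefS dP ltiN) (has_logder_coefS dQ ltiN).
apply: eq_bigr => k _; congr (_ * _).
apply: IH; first by rewrite ltnS leq_subr.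
by rewrite (leq_trans (leq_subr _ _)) // ltnW.
Qed.

Lemma has_logder_eq P Q u :
  (forall N, has_logder N P u) -> (forall N, has_logder N Q u) -> P = Q.
Proof.
by move=> dP dQ; apply/polyP=> i; apply: (has_logder_uniq (dP i) (dQ i)).
Qed.

Definition exp_upto (A : nat -> K) N : {poly K} :=
  \sum_(k < N.+1) (k`!%:R)^-1 *: (\poly_(i < N.+1) A i) ^+ k.

(** The derivative of the truncated exponential of p misses only the term
    p' p^N / N!, and 'X divides p. *)
Lemma has_logder_exp (A : nat -> K) N :
  A 0%N = 0 -> has_logder N (exp_upto A N) (fun n => n%:R * A n).
Proof.
move=> A0; set p := \poly_(i < N.+1) A i.
have pX : 'X %| p by rewrite -['X]subr0 -polyC0 dvdp_XsubCl rootE horner_coef0 coef_poly A0.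
have genE : gen_upto (fun n => n%:R * A n) N = p^`().
  apply/polyP=> k; rewrite coef_poly coef_deriv coef_poly ltnS.
  by case: ltnP => _; rewrite ?mulr_natl ?mul0rn.
apply/andP; split; last first.
  rewrite /exp_upto coef_sum big_ord_recl /= fact0 invr1 scale1r expr0 coef1 /=.
  rewrite big1 ?addr0 // => k _; rewrite coefZ exprS coef0M coef_poly /= A0.
  by rewrite mul0r mulr0.
rewrite genE.
have -> : (exp_upto A N)^`() = p^`() * \sum_(k < N) (k`!%:R)^-1 *: p ^+ k.
  rewrite /exp_upto raddf_sum /= big_ord_recl /= expr0 derivZ -polyC1 derivC.
  rewrite scaler0 add0r mulr_sumr; apply: eq_bigr => k _.
  rewrite derivZ deriv_exp /= -scaler_nat scalerA factS natrM invfM mulrAC.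
  by rewrite mulVf ?pnatr_eq0 // mul1r -scalerAr.
rewrite /exp_upto big_ord_recr /= -/p mulrDr opprD addrA subrr sub0r dvdpNr.
rewrite dvdp_mull // dvdpZr ?invr_eq0 ?pnatr_eq0 -?lt0n ?fact_gt0 //.
exact: dvdp_exp2r.
Qed.

(** The coefficients of [fps_exp] come from truncations at different orders; these
    agree because they satisfy the same differential equation. *)
Lemma fps_exp_coef (A : nat -> K) N i :
  A 0%N = 0 -> (i <= N)%N -> fps_exp A i = (exp_upto A N)`_i.
Proof.
move=> A0 leiN; apply: (has_logder_uniq (has_logder_exp i A0)) (leqnn i).
exact: has_logder_leq leiN (has_logder_exp N A0).
Qed.

Lemma fps_exp_fraction (A : nat -> K) P Q u v :
  A 0%N = 0 ->
  (forall n, (0 < n)%N -> n%:R * A n + v n = u n) ->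
  (forall N, has_logder N P u) -> (forall N, has_logder N Q v) ->
  fps_is_fraction (fps_exp A) P Q.
Proof.
move=> A0 Auv dP dQ n.
have d := has_logder_ext Auv (has_logderM (has_logder_exp n A0) (dQ n)).
rewrite -(has_logder_uniq d (dP n) (leqnn n)) coefM.
by apply: eq_bigr => i _; rewrite (@fps_exp_coef _ n) // -ltnS.
Qed.

End LogarithmicDerivative.

(** * Sums over finite types *)

Lemma sum_unity_powers (C : numFieldType) m (z : C) :
  z ^+ m = 1 -> \sum_(u < m) z ^+ u = m%:R * (z == 1)%:R.
Proof.
move=> zm1; case: eqVneq => [->|z_neq1].
  rewrite mulr1 -[in RHS](card_ord m) -sum1_card natr_sum.
  by apply: eq_bigr => u _; rewrite expr1n.
apply: (mulfI (_ : z - 1 != 0)); first by rewrite subr_eq0.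
by rewrite -subrX1 zm1 subrr !mulr0.
Qed.

Lemma sum_bij_on (T : finType) (V : nmodType) (D : pred T) (h h' : T -> T)
    (G : T -> V) :
  (forall x, D x -> D (h x) /\ h' (h x) = x) ->
  (forall x, D x -> D (h' x) /\ h (h' x) = x) ->
  \sum_(x | D x) G (h x) = \sum_(x | D x) G x.
Proof.
move=> hD h'D; rewrite [RHS](reindex_onto h h') => [|x /h'D[]//].
apply: eq_bigl => x; apply/idP/andP => [/hD[-> ->]|[Dhx /eqP <-]] //.
by case: (h'D _ Dhx).
Qed.

(** * Power residue characters and their Jacobi sums *)

Section PowerResidueCharacter.
Variables (K : finFieldType) (m : nat) (omega : K) (xi : algC).
Hypotheses (omega_prim : m.-primitive_root omega) (xi_prim : m.-primitive_root xi).

Let N := #|K|.-1.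

(** The character of order m on the units of K that sends x to xi^k when
    x^((|K|-1)/m) = omega^k.  Fixing omega, rather than a generator of the units
    of K, makes the characters of a field and of its extensions comparable. *)
Definition chi (x : K) : algC :=
  xi ^+ odflt 0%N (omap val [pick k : 'I_m | x ^+ (N %/ m) == omega ^+ k]).

Let N_gt0 : (0 < N)%N.
Proof. by have := card_finNzRing_gt1 K; rewrite /N; case: #|K| => [|[]]. Qed.

Let m_gt0 : (0 < m)%N. Proof. exact: prim_order_gt0 omega_prim. Qed.

Lemma expf_card1 (x : K) : x != 0 -> x ^+ N = 1.
Proof.
move=> x0; apply: (mulfI x0); rewrite mulr1 -exprS /N prednK ?expf_card //.
exact: ltnW (card_finNzRing_gt1 K).
Qed.

Lemma finfield_prim_root : exists g : K, N.-primitive_root g.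
Proof.
have sz : size (enum [set~ 0 : K]) = N by rewrite -cardE cardsC1.
have : has N.-primitive_root (enum [set~ 0 : K]).
  apply: has_prim_root; rewrite ?sz ?enum_uniq //.
  apply/allP=> x; rewrite mem_enum !inE => x0; rewrite unity_rootE.
  exact/eqP/expf_card1.
by move=> /hasP[g _ gP]; exists g.
Qed.

Lemma prim_root_dvd_card : (m %| N)%N.
Proof.
rewrite (prim_order_dvd omega_prim) expf_card1 //.
apply/eqP=> om0; have /eqP := prim_expr_order omega_prim.
by rewrite om0 expr0n eqn0Ngt m_gt0 eq_sym oner_eq0.
Qed.

Lemma chiE x k : x ^+ (N %/ m) = omega ^+ k -> chi x = xi ^+ k.
Proof.
move=> xk; rewrite /chi; case: pickP => [k' /=|/(_ (Ordinal (ltn_pmod k m_gt0)))].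
  rewrite xk (eq_prim_root_expr omega_prim) => /eqP kk'.
  by apply/eqP; rewrite (eq_prim_root_expr xi_prim) kk'.
by rewrite /= (prim_expr_mod omega_prim) xk eqxx.
Qed.

Lemma chi_index x : x != 0 -> exists k, x ^+ (N %/ m) = omega ^+ k.
Proof.
move=> x0; have xm1 : x ^+ (N %/ m) ^+ m = 1.
  by rewrite -exprM divnK ?prim_root_dvd_card // expf_card1.
by have [k] := prim_rootP omega_prim xm1; exists k.
Qed.

Lemma chiM x y : x != 0 -> y != 0 -> chi (x * y) = chi x * chi y.
Proof.
move=> /chi_index[k xk] /chi_index[k' yk'].
by rewrite (chiE xk) (chiE yk') -exprD; apply: chiE; rewrite exprMn xk yk' exprD.
Qed.

Lemma chi1 : chi 1 = 1.
Proof. by rewrite (@chiE 1 0) ?expr0 // expr1n. Qed.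

Lemma chi_unity x : chi x ^+ m = 1.
Proof. by rewrite /chi exprAC (prim_expr_order xi_prim) expr1n. Qed.

Lemma chi_neq0 x : chi x != 0.
Proof.
apply/eqP=> x0; have /eqP := chi_unity x.
by rewrite x0 expr0n eqn0Ngt m_gt0 eq_sym oner_eq0.
Qed.

Lemma chiV x : x != 0 -> chi x^-1 = (chi x)^-1.
Proof.
move=> x0; apply: (mulfI (chi_neq0 x)).
by rewrite -chiM ?invr_eq0 // !divff ?chi1 ?chi_neq0.
Qed.

Lemma chiX x k : x != 0 -> chi (x ^+ k) = chi x ^+ k.
Proof.
move=> x0; elim: k => [|k IH]; first exact: chi1.
by rewrite !exprS chiM ?expf_neq0 // IH.
Qed.

Lemma chi_surj : exists2 g, g != 0 & chi g = xi.
Proof.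
have [g gP] := finfield_prim_root.
have wP : m.-primitive_root (g ^+ (N %/ m)) by apply: dvdn_prim_root prim_root_dvd_card.
have [k omk] := prim_rootP wP (prim_expr_order omega_prim).
exists (g ^+ k); last by rewrite (@chiE _ 1) ?expr1 // omk -!exprM mulnC.
apply/expf_neq0/eqP=> g0; have /eqP := prim_expr_order gP.
by rewrite g0 expr0n eqn0Ngt N_gt0 eq_sym oner_eq0.
Qed.

(** Both sides vanish unless x is an m-th power y^m, and then the roots are the
    y omega^t, t < m. *)
Lemma card_roots x : x != 0 ->
  #|[set y | y ^+ m == x]|%:R = m%:R * (chi x == 1)%:R :> algC.
Proof.
move=> x0; have := chi_index x0 => -[k xk]; rewrite (chiE xk).
rewrite -(prim_order_dvd xi_prim) (prim_order_dvd omega_prim) -xk.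
case: eqP => [x1|nx1]; rewrite ?mulr1 ?mulr0; last first.
  apply/eqP; rewrite pnatr_eq0 cards_eq0; apply/set0Pn=> -[y].
  rewrite inE => /eqP yx; apply: nx1; rewrite -yx -exprM mulnC divnK ?prim_root_dvd_card //.
  apply: expf_card1; apply: contraNneq x0 => y0.
  by rewrite -yx y0 expr0n eqn0Ngt m_gt0.
have [g gP] := finfield_prim_root.
have [i xi0] := prim_rootP gP (expf_card1 x0); rewrite xi0 in x0 x1 *.
have /dvdnP[j ij] : (m %| i)%N.
  move: x1; rewrite -exprM => /eqP; rewrite -(prim_order_dvd gP).
  rewrite -{1}(divnK prim_root_dvd_card) mulnC dvdn_pmul2r // divn_gt0 //.
  by rewrite dvdn_leq // prim_root_dvd_card.
have gj0 : g ^+ j != 0.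
  apply: contraNneq x0 => gj0; rewrite ij exprM gj0 expr0n.
  by rewrite eqn0Ngt m_gt0.
suff -> : [set y | y ^+ m == g ^+ i] = [set g ^+ j * omega ^+ t | t : 'I_m].
  rewrite card_imset ?card_ord // => t t' /(mulfI gj0)/eqP.
  rewrite (eq_prim_root_expr omega_prim) !modn_small // => /eqP.
  exact: val_inj.
apply/setP=> y; rewrite inE; apply/eqP/imsetP => [yx|[t _ ->]]; last first.
  by rewrite exprMn -exprM -ij exprAC (prim_expr_order omega_prim) expr1n mulr1.
have /(prim_rootP omega_prim)[t yt] : (y / g ^+ j) ^+ m = 1.
  by rewrite expr_div_n yx ij exprM divff // expf_neq0.
by exists t => //; rewrite -yt mulrC divfK.
Qed.

(** A nontrivial character has sum 0: multiply the variable by an element whose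
    image under the character is not 1. *)
Lemma sum_chi u : ~~ (m %| u)%N -> \sum_(x | x != 0) chi x ^+ u = 0.
Proof.
move=> mu; have [g g0 gxi] := chi_surj.
have xiu : xi ^+ u - 1 != 0 by rewrite subr_eq0 -(prim_order_dvd xi_prim).
apply: (mulfI xiu); rewrite mulr0 mulrBl mul1r.
rewrite [X in _ - X](reindex_inj (mulfI g0)) /= mulr_sumr; apply/eqP.
rewrite subr_eq0; apply/eqP; apply: eq_big => x; first by rewrite mulf_eq0 (negbTE g0).
by move=> x0; rewrite chiM // exprMn gxi.
Qed.

Lemma sum_chi01 u :
  ~~ (m %| u)%N -> \sum_(x | (x != 0) && (x != 1)) chi x ^+ u = -1.
Proof.
move=> /sum_chi; rewrite (bigD1 1) ?oner_eq0 //= chi1 expr1n => /eqP.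
by rewrite addrC addr_eq0 => /eqP.
Qed.

(** The terms w = 0 and w = 1 are left out even when an exponent is 0. *)
Definition jac u v : algC :=
  \sum_(w | (w != 0) && (w != 1)) chi w ^+ u * chi (1 - w) ^+ v.

Let chi_dvd u x : (m %| u)%N -> chi x ^+ u = 1.
Proof. by move=> /dvdnP[k ->]; rewrite mulnC exprM chi_unity expr1n. Qed.

Lemma jacC u v : jac u v = jac v u.
Proof.
rewrite /jac -(sum_bij_on (D := fun w => (w != 0) && (w != 1)) (h := fun w => 1 - w)
  (h' := fun w => 1 - w)); first last.
1,2: move=> x /andP[x0 x1]; rewrite subr_eq0 eq_sym x1 subKr; split=> //.
1,2: by rewrite -subr_eq0 addrAC subrr sub0r oppr_eq0.
by apply: eq_bigr => w _; rewrite subKr mulrC.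
Qed.

Lemma jac_triv u v : (m %| u)%N -> (m %| v)%N -> jac u v = #|K|%:R - 2.
Proof.
move=> mu mv; rewrite /jac (eq_bigr (fun=> 1)); last first.
  by move=> w _; rewrite !chi_dvd ?mulr1.
have -> : #|K| = #|[pred w : K | (w != 0) && (w != 1)]|.+2.
  rewrite (cardD1 0) (cardD1 1) !inE oner_eq0 /= add1n.
  by congr _.+2; apply: eq_card => w; rewrite !inE andbC andbT.
by rewrite -addn2 natrD addrK -sum1_card natr_sum.
Qed.

Lemma jac_half_triv u v : (m %| u)%N -> ~~ (m %| v)%N -> jac u v = -1.
Proof.
move=> mu mv; rewrite jacC -(sum_chi01 mv); apply: eq_bigr => w _.
by rewrite (chi_dvd _ mu) mulr1.
Qed.

(** The involution w |-> w / (w - 1) turns chi(w)^u chi(1 - w)^-u into chi(w)^u. *)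
Lemma jac_opp u v :
  chi (-1) = 1 -> ~~ (m %| u)%N -> (m %| u + v)%N -> jac u v = -1.
Proof.
move=> chiN1 mu muv; rewrite -(sum_chi01 mu).
have h (x : K) : (x != 0) && (x != 1) ->
    (x / (x - 1) != 0) && (x / (x - 1) != 1) /\ x / (x - 1) / (x / (x - 1) - 1) = x.
  move=> /andP[x0 x1]; have x1' : x - 1 != 0 by rewrite subr_eq0.
  split; last by field; rewrite x1' mulN1r opprB addrC subrK oner_eq0.
  rewrite mulf_neq0 ?invr_eq0 //= -subr_eq0.
  have -> : x / (x - 1) - 1 = (x - 1)^-1 by field.
  by rewrite invr_eq0.
rewrite -(sum_bij_on (D := fun w => (w != 0) && (w != 1)) (h := fun w => w / (w - 1))
  (h' := fun w => w / (w - 1))) //.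
apply: eq_bigr => w /andP[w0 w1]; have w1' : w - 1 != 0 by rewrite subr_eq0.
rewrite chiM ?invr_eq0 // chiV // exprMn exprVn; congr (_ * _).
have -> : 1 - w = (-1) * (w - 1) by ring.
rewrite chiM ?oppr_eq0 ?oner_eq0 // chiN1 mul1r.
apply: (mulfI (expf_neq0 u (chi_neq0 (w - 1)))).
by rewrite -exprD chi_dvd // divff // expf_neq0 // chi_neq0.
Qed.

(** In the double sum over x and y, the diagonal gives |K| - 2.  Off the diagonal,
    (x, y) |-> (x / y, (1 - x) / (1 - y)) permutes the pairs of distinct elements
    other than 0 and 1, and the remaining sum over x != y is the product of two
    complete character sums minus the sum of chi^(u+v), that is (-1)(-1) + 1. *)
Lemma jac_mul_inv u v :
  ~~ (m %| u)%N -> ~~ (m %| v)%N -> ~~ (m %| u + v)%N ->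
  jac u v * (\sum_(w | (w != 0) && (w != 1)) (chi w ^+ u * chi (1 - w) ^+ v)^-1)
    = #|K|%:R.
Proof.
move=> mu mv muv; pose D1 (w : K) := (w != 0) && (w != 1).
pose D (p : K * K) := D1 p.1 && (D1 p.2 && (p.2 != p.1)).
pose F w := chi w ^+ u * chi (1 - w) ^+ v.
have F0 w : F w != 0 by rewrite mulf_neq0 // expf_neq0 ?chi_neq0.
have offdiag (G : K -> K -> algC) : \sum_(x | D1 x) \sum_(y | D1 y) G x y =
    \sum_(x | D1 x) G x x + \sum_(p | D p) G p.1 p.2.
  rewrite -(pair_big_dep D1 (fun x y => D1 y && (y != x)) G) -big_split /=.
  apply: eq_bigr => x Dx.
  by rewrite (bigD1 x).
rewrite /jac big_distrlr /= (offdiag (fun x y => F x * (F y)^-1)).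
have -> : \sum_(x | D1 x) F x * (F x)^-1 = #|K|%:R - 2.
  rewrite -(jac_triv (dvdn0 m) (dvdn0 m)); apply: eq_bigr => x _.
  by rewrite divff // !expr0 mulr1.
pose h (p : K * K) := (p.1 / p.2, (1 - p.1) / (1 - p.2)).
(* The solution (x, y) of x = p.1 y and 1 - x = p.2 (1 - y). *)
pose h' (p : K * K) := (p.1 * (p.2 - 1) / (p.2 - p.1), (p.2 - 1) / (p.2 - p.1)).
have -> : \sum_(p | D p) F p.1 / F p.2 =
    \sum_(p | D p) chi (h p).1 ^+ u * chi (h p).2 ^+ v.
  apply: eq_bigr => -[x y] /andP[/andP[/= x0 x1] /andP[/andP[/= y0 y1] xy]].
  have [x2 y2] : 1 - x != 0 /\ 1 - y != 0 by rewrite !subr_eq0 ![1 == _]eq_sym.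
  rewrite /h /= (chiM x0) ?(chiM x2) ?invr_eq0 // (chiV y0) (chiV y2).
  by rewrite !exprMn !exprVn /F invfM; ring.
rewrite (sum_bij_on (h' := h') (fun p => chi p.1 ^+ u * chi p.2 ^+ v)).
- have := offdiag (fun x y => chi x ^+ u * chi y ^+ v).
  rewrite -big_distrlr /= !sum_chi01 // mulrNN mulr1 => /eqP.
  rewrite (eq_bigr (fun x => chi x ^+ (u + v))) => [|x _]; last by rewrite exprD.
  rewrite sum_chi01 // addrC -subr_eq opprK => /eqP <-.
  by ring.
- move=> [x y] /andP[/andP[/= x0 x1] /andP[/andP[/= y0 y1] xy]].
  have [x1' y1' xy'] : [/\ x - 1 != 0, y - 1 != 0 & y - x != 0] by rewrite !subr_eq0.
  have y2 : 1 - y != 0 by rewrite subr_eq0 eq_sym.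
  have x2 : 1 - x != 0 by rewrite subr_eq0 eq_sym.
  have E1 : x / y - 1 = - (y - x) / y by field.
  have E2 : (1 - x) / (1 - y) - 1 = (y - x) / (1 - y) by field.
  have E3 : (1 - x) / (1 - y) - x / y = (y - x) / (y * (1 - y)) by field; rewrite y2.
  split; last by rewrite /h' /h /=; congr (_, _); rewrite E2 E3; field; rewrite ?y2 ?xy' ?y0.
  rewrite /D /D1 /h /= -!(subr_eq0 _ 1) -(subr_eq0 _ (x / y)) E1 E2 E3.
  by rewrite !mulf_neq0 ?invr_eq0 ?oppr_eq0 ?mulf_neq0.
move=> [x y] /andP[/andP[/= x0 x1] /andP[/andP[/= y0 y1] xy]].
have [x1' y1' xy'] : [/\ x - 1 != 0, y - 1 != 0 & y - x != 0] by rewrite !subr_eq0.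
have E1 : x * (y - 1) / (y - x) - 1 = y * (x - 1) / (y - x) by field.
have E2 : (y - 1) / (y - x) - 1 = (x - 1) / (y - x) by field.
have E3 : (y - 1) / (y - x) - x * (y - 1) / (y - x) = - ((x - 1) * (y - 1)) / (y - x) by field.
split.
  rewrite /D /D1 /h' /= -!(subr_eq0 _ 1) -(subr_eq0 _ (x * _ / _)) E1 E2 E3.
  by rewrite !mulf_neq0 ?invr_eq0 ?oppr_eq0 ?mulf_neq0.
rewrite /h /h' /= -(opprB _ 1) E1 -(opprB ((y - 1) / _) 1) E2.
by congr (_, _); field; rewrite xy' ?y1' ?oppr_eq0 ?x1'.
Qed.

Lemma jac_frobenius p t u v : p \in [pchar K] -> jac (p ^ t * u) (p ^ t * v) = jac u v.
Proof.
move=> pK; have pnat : [pchar K].-nat (p ^ t)%N.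
  by rewrite pnatX pnatE ?(pcharf_prime pK) // pK.
have frobB (x y : K) : (x - y) ^+ (p ^ t) = x ^+ (p ^ t) - y ^+ (p ^ t).
  by apply/(canRL (addrK _)); rewrite -exprDn_pchar // subrK.
have frob_inj : injective (fun x : K => x ^+ (p ^ t)).
  move=> x y /eqP; rewrite -subr_eq0 -frobB expf_eq0 subr_eq0.
  by case/andP=> _ /eqP.
have frob_eq (x y : K) : (x ^+ (p ^ t) == y ^+ (p ^ t)) = (x == y) := inj_eq frob_inj x y.
rewrite /jac [RHS](reindex_inj frob_inj) /=; apply: eq_big => w.
  rewrite -[X in _ = _ && (_ != X)](expr1n K (p ^ t)) frob_eq expf_eq0 expn_gt0.
  by rewrite (prime_gt0 (pcharf_prime pK)).
move=> /andP[w0 w1]; rewrite chiX //.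
have -> : 1 - w ^+ (p ^ t) = (1 - w) ^+ (p ^ t) by rewrite frobB expr1n.
by rewrite chiX ?subr_eq0 1?eq_sym // -!exprM.
Qed.

(** If p^t = -1 mod m then chi^(p^t) is the inverse of chi, and the Frobenius
    automorphism identifies J with the sum of the inverses of its terms. *)
Lemma jac_sqr p t u v : p \in [pchar K] -> (m %| (p ^ t).+1)%N ->
  ~~ (m %| u)%N -> ~~ (m %| v)%N -> ~~ (m %| u + v)%N ->
  jac u v ^+ 2 = #|K|%:R.
Proof.
move=> pK mpt mu mv muv; rewrite -(jac_mul_inv mu mv muv) expr2; congr (_ * _).
rewrite -(jac_frobenius t u v pK); apply: eq_bigr => w _.
have chiF x k : chi x ^+ (p ^ t * k) = (chi x ^+ k)^-1.
  apply: (mulfI (expf_neq0 k (chi_neq0 x))).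
  rewrite divff; last by rewrite expf_neq0 ?chi_neq0.
  by rewrite -exprD chi_dvd // -mulSn dvdn_mulr.
by rewrite !chiF invfM mulrC.
Qed.

(** A rational value is fixed by the automorphism of the algebraic numbers that
    raises the m-th roots of unity to the power k. *)
Lemma jac_galois u v (r : int) k :
  coprime k m -> jac u v = r%:~R -> jac (k * u) (k * v) = jac u v.
Proof.
move=> /Qn_aut_exists[s sE] Jr; rewrite Jr -(rmorph_int s) -Jr.
have sX x e : s (chi x ^+ e) = chi x ^+ (k * e).
  by rewrite exprM -sE ?chi_unity // rmorphXn.
by rewrite rmorph_sum; apply: eq_bigr => w _; rewrite rmorphM -!sX.
Qed.

End PowerResidueCharacter.

(** * Jacobi sums in the semiprimitive case *)

(** Among the odd numbers below 2l, only l is not prime to 2l. *)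
Lemma coprime_odd_double l j :
  prime l -> odd l -> (j < l)%N -> j != l./2 -> coprime j.*2.+1 (2 * l).
Proof.
move=> l_prime l_odd jl jl2.
rewrite coprime_sym coprimeMl coprime2n /= odd_double prime_coprime //=.
apply/negP => /dvdnP[c cE]; have c_eq1 : c = 1%N by move: cE jl l_odd; nia.
by move: cE jl2; rewrite c_eq1; lia.
Qed.

Lemma odd_prime_not_dvdz2 l : prime l -> odd l -> ~~ (l %| 2)%Z.
Proof.
move=> l_prime l_odd; have l_gt1 := prime_gt1 l_prime.
by apply/negP => /(@dvdn_leq l 2 isT); move: l_odd l_gt1; lia.
Qed.

Section TwicePrime.
Variables (K : finFieldType) (l : nat) (omega : K) (xi : algC).
Let m := (2 * l)%N.
Hypotheses (l_prime : prime l) (l_odd : odd l).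
Hypotheses (omega_prim : m.-primitive_root omega) (xi_prim : m.-primitive_root xi).
Hypothesis chiN1 : chi m omega xi (-1) = 1.
Local Notation chi := (chi m omega xi).
Local Notation jac := (jac m omega xi).

(** Each w contributes c + c^3 + ... + c^(2l-1) where c^(2l) = 1; this is 0 unless
    c is 1 or -1, when it is l c. *)
Lemma sum_odd_jac u v : exists z : int,
  \sum_(j < l) jac (j.*2.+1 * u) (j.*2.+1 * v) = z%:~R * l%:R.
Proof.
suff H w : exists z : int, \sum_(j < l) chi w ^+ (j.*2.+1 * u) * chi (1 - w) ^+ (j.*2.+1 * v)
    = z%:~R * l%:R.
  rewrite exchange_big.
  apply: (big_ind (fun x : algC => exists z : int, x = z%:~R * l%:R)) =>
    [|_ _ [z ->] [z' ->]|w _]; last exact: H.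
    by exists 0; rewrite mul0r.
  by exists (z + z'); rewrite rmorphD /= mulrDl.
pose c := chi w ^+ u * chi (1 - w) ^+ v.
have c1 : (c ^+ 2) ^+ l = 1.
  have chim x k : chi x ^+ k ^+ m = 1 by rewrite exprAC (chi_unity omega xi_prim) expr1n.
  by rewrite -exprM -/m exprMn !chim mulr1.
have -> : \sum_(j < l) chi w ^+ (j.*2.+1 * u) * chi (1 - w) ^+ (j.*2.+1 * v) =
    c * \sum_(j < l) (c ^+ 2) ^+ j.
  rewrite mulr_sumr; apply: eq_bigr => j _.
  by rewrite !(mulnC j.*2.+1) !exprM -exprMn -/c exprS -mul2n exprM.
rewrite sum_unity_powers //; case: eqP => [/eqP|_]; last by exists 0; rewrite mulr0 mulr0 mul0r.
rewrite mulr1 sqrf_eq1 => /orP[]/eqP->; first by exists 1.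
by exists (-1); rewrite rmorphN1.
Qed.

(** One of u, v, u + v is even, so at least one of the characters chi^(lu),
    chi^(lv), chi^(l(u+v)) is trivial. *)
Lemma jac_mul_l u v : jac (l * u) (l * v) = -1 \/ jac (l * u) (l * v) = #|K|%:R - 2.
Proof.
have ml w : (m %| l * w)%N = ~~ odd w.
  by rewrite /m mulnC dvdn_pmul2l ?prime_gt0 // dvdn2.
have muv : (m %| l * u + l * v)%N = (odd u == odd v).
  by rewrite -mulnDr ml oddD negb_add.
case: (boolP (odd u)) => ou; case: (boolP (odd v)) => ov.
- by left; apply: jac_opp; rewrite ?ml ?muv ?ou ?ov.
- by left; rewrite jacC; apply: jac_half_triv; rewrite ?ml ?ou ?ov.
- by left; apply: jac_half_triv; rewrite ?ml ?ou ?ov.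
- by right; apply: jac_triv; rewrite ?ml ?ou ?ov.
Qed.

(** J = s r with s = 1 or -1.  Modulo l, [sum_odd_jac], [jac_galois] and
    [jac_mul_l] give (l - 1) J - 1 = 0, that is J = -1; as r = (-1)^b mod l and l
    is odd, this determines s. *)
Lemma jac_semiprimitive p t r b u v :
  p \in [pchar K] -> (m %| (p ^ t).+1)%N ->
  #|K| = (r ^ 2)%N -> (r%:Z = (-1) ^+ b %[mod l])%Z ->
  ~~ (m %| u)%N -> ~~ (m %| v)%N -> ~~ (m %| u + v)%N ->
  jac u v = - (-1) ^+ b * r%:R.
Proof.
move=> pK mpt cardK rb mu mv muv.
have /eqP := jac_sqr omega_prim xi_prim pK mpt mu mv muv.
rewrite cardK natrX eqf_sqr => Jr.
have [s [s2 Js]] : exists s : int, s ^+ 2 = 1 /\ jac u v = (s * r%:Z)%:~R.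
  case/orP: Jr => /eqP->; first by exists 1; rewrite mul1r expr1n.
  by exists (-1); rewrite sqrrN expr1n mulN1r rmorphN.
have [z zE] := sum_odd_jac u v.
have l_half : (l./2 < l)%N by rewrite ltn_half_double -addnn -{1}(addn0 l) ltn_add2l prime_gt0.
have [d [dE dl]] : exists d : int, jac (l * u) (l * v) = d%:~R /\ (l %| d + 1)%Z.
  have [-> | ->] := jac_mul_l u v; first by exists (-1); rewrite rmorphN1 addNr dvdz0.
  exists (r%:Z ^+ 2 - 2); split; first by rewrite rmorphB rmorphXn /= cardK natrX.
  have : (r%:Z ^+ 2 = 1 %[mod l])%Z.
    by rewrite -modzXm rb modzXm -exprM mulnC exprM sqrrN !expr1n.
  by move/eqP; rewrite eqz_mod_dvd -addrA.
have : (l %| (l%:Z - 1) * (s * r%:Z) + d)%Z.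
  suff -> : (l%:Z - 1) * (s * r%:Z) + d = z * l%:Z by rewrite dvdz_mull.
  apply: (intr_inj (R := algC)); rewrite [RHS]rmorphM -zE rmorphD rmorphM /= -Js -dE.
  (* The odd number l is 2j + 1 for j = l./2. *)
  rewrite (bigD1 (Ordinal l_half)) //=.
  have -> : (l./2).*2.+1 = l by rewrite -[RHS]odd_double_half l_odd.
  rewrite addrC; congr (_ + _).
  rewrite (eq_bigr (fun=> jac u v)) => [|j jl]; last first.
    apply: jac_galois Js => //.
    exact: coprime_odd_double.
  rewrite sumr_const cardC1 card_ord -mulr_natl; congr (_ * _).
  by rewrite -subn1 natrB ?prime_gt0 // rmorphB.
move=> /dvdzP[x xE]; have {dl} /dvdzP[y yE] := dl.
have lsr : (l %| s * r%:Z + 1)%Z.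
  apply/dvdzP; exists (s * r%:Z + y - x); rewrite mulrBl mulrDl -xE -yE.
  by move: l%:Z (r%:Z) => l' r'; ring.
have l_not_dvd2 := odd_prime_not_dvdz2 l_prime l_odd.
have {rb} /eqP := rb; rewrite eqz_mod_dvd => lrb.
suff s_b : s = - (-1) ^+ b by rewrite Js s_b rmorphM rmorphN rmorph_sign.
have {lsr} /dvdzP[c cE] := lsr; have {lrb} /dvdzP[e eE] := lrb.
apply/eqP; apply: contraNT l_not_dvd2; rewrite -signr_odd in eE *; move: (odd b) cE eE => {}b.
have /eqP := s2; rewrite sqrf_eq1 => /orP[]/eqP->.
  case: b => /=; rewrite ?expr0 ?expr1 ?opprK ?eqxx // => cE eE _.
  apply/dvdzP; exists (c - e); rewrite mulrBl -cE -eE.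
  by move: (r%:Z) => r'; ring.
case: b => /=; rewrite ?expr0 ?expr1 ?eqxx // => cE eE _.
apply/dvdzP; exists (c + e); rewrite mulrDl -cE -eE.
by move: (r%:Z) => r'; ring.
Qed.
End TwicePrime.

(** * Points at finite distance and at infinity *)

Lemma proj_point_scale (K : finFieldType) (c : K) (v : 'rV[K]_3) :
  c != 0 -> proj_point (c *: v) = proj_point v.
Proof.
move=> c0; apply/setP=> w; apply/imsetP/imsetP => -[d + ->]; rewrite inE => d0.
  by exists (d * c); [rewrite inE mulf_neq0 | rewrite scalerA].
exists (d / c); last by rewrite scalerA divfK.
by rewrite inE mulf_neq0 ?invr_eq0.
Qed.

Lemma proj_point_eqP (K : finFieldType) (v w : 'rV[K]_3) :
  proj_point v = proj_point w -> exists2 c, c != 0 & v = c *: w.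
Proof.
move=> vw; have : v \in proj_point v.
  by apply/imsetP; exists 1; rewrite ?inE ?oner_eq0 ?scale1r.
by rewrite vw => /imsetP[c + ->]; rewrite inE => c0; exists c.
Qed.

Lemma inord3_inj : [/\ inord 0 != inord 1 :> 'I_3, inord 0 != inord 2 :> 'I_3
  & inord 1 != inord 2 :> 'I_3].
Proof. by split; rewrite -val_eqE /= !inordK. Qed.

Lemma ord3E (k : 'I_3) : [|| k == inord 0, k == inord 1 | k == inord 2].
Proof. by rewrite -!val_eqE /= !inordK //; case: k => -[|[|[]]]. Qed.

Definition row3 (K : finFieldType) (x y z : K) : 'rV[K]_3 :=
  \row_k (if k == inord 0 then x else if k == inord 1 then y else z).

Lemma row3E (K : finFieldType) (x y z : K) :
  [/\ row3 x y z 0 (inord 0) = x, row3 x y z 0 (inord 1) = y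
    & row3 x y z 0 (inord 2) = z].
Proof.
have [h01 h02 h12] := inord3_inj.
by rewrite !mxE !eqxx ![inord _ == inord 0]eq_sym (negbTE h01) (negbTE h02) eq_sym (negbTE h12).
Qed.

Lemma row3_eta (K : finFieldType) (v : 'rV[K]_3) :
  v = row3 (v 0 (inord 0)) (v 0 (inord 1)) (v 0 (inord 2)).
Proof.
apply/rowP=> k; have [e0 e1 e2] := row3E (v 0 (inord 0)) (v 0 (inord 1)) (v 0 (inord 2)).
by case/or3P: (ord3E k) => /eqP->; rewrite ?e0 ?e1 ?e2.
Qed.

(** A point has exactly one representative with third coordinate 1, or with third
    coordinate 0 and first coordinate 1; no point has both of these equal to 0
    because a != 0. *)
Lemma card_proj_diag (K : finFieldType) m (a b c : K) :
  (0 < m)%N -> a != 0 ->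
  #|[set proj_point v | v : 'rV[K]_3 & (v != 0) &&
      (a * v 0 (inord 1) ^+ m == b * v 0 (inord 0) ^+ m + c * v 0 (inord 2) ^+ m)]|
  = (#|[set p : K * K | a * p.2 ^+ m == b * p.1 ^+ m + c]%R|
     + #|[set y : K | y ^+ m == b / a]%R|)%N.
Proof.
move=> m0 a0.
pose on_curve (v : 'rV[K]_3) :=
  a * v 0 (inord 1) ^+ m == b * v 0 (inord 0) ^+ m + c * v 0 (inord 2) ^+ m.
have on_curveZ d v : d != 0 -> on_curve (d *: v) = on_curve v.
  move=> d0; rewrite /on_curve !mxE !exprMn !(mulrCA _ (d ^+ m)) -mulrDr.
  by rewrite (inj_eq (mulfI (expf_neq0 m d0))).
pose S := [set p : K * K | a * p.2 ^+ m == b * p.1 ^+ m + c].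
pose T := [set y : K | y ^+ m == b / a].
pose S' := [set row3 p.1 p.2 1 | p in S]; pose T' := [set row3 1 y 0 | y in T].
have S'2 v : v \in S' -> v 0 (inord 2) = 1.
  by case/imsetP=> p _ ->; have [] := row3E p.1 p.2 1.
have T'2 v : v \in T' -> v 0 (inord 2) = 0 /\ v 0 (inord 0) = 1.
  by case/imsetP=> y _ ->; have [] := row3E 1 y 0.
have disj : [disjoint S' & T'].
  apply/pred0P=> v /=; apply/negP=> /andP[/S'2 v1 /T'2[v0 _]].
  by have := oner_neq0 K; rewrite -v1 v0 eqxx.
transitivity #|[set proj_point v | v in S' :|: T']|; last first.
  rewrite card_in_imset => [|v w vST wST /proj_point_eqP[d d0 vw]].
    move: disj; rewrite cardsU -setI_eq0 => /eqP->; rewrite cards0 subn0.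
    congr (_ + _)%N; rewrite card_imset //.
      move=> [x y] [x' y'] /= e; have := row3E x y 1; rewrite e.
      by have [-> -> _] := row3E x' y' 1; case=> -> ->.
    move=> y y' e; have [_ + _] := row3E 1 y 0; rewrite e.
    by have [_ -> _] := row3E 1 y' 0.
  have v2 : v 0 (inord 2) = d * w 0 (inord 2) by rewrite vw mxE.
  have v0 : v 0 (inord 0) = d * w 0 (inord 0) by rewrite vw mxE.
  suff d1 : d = 1 by rewrite vw d1 scale1r.
  move: vST wST; rewrite !inE => /orP[/S'2 hv|/T'2[hv hv0]] /orP[/S'2 hw|/T'2[hw hw0]].
  - by move: v2; rewrite hv hw mulr1.
  - by move: v2 => /eqP; rewrite hv hw mulr0 oner_eq0.
  - by move: v2 => /eqP; rewrite hv hw mulr1 eq_sym (negbTE d0).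
  - by move: v0; rewrite hv0 hw0 mulr1.
congr #|pred_of_set _|; apply/setP=> B.
apply/imsetP/imsetP=> -[v vP ->]; last first.
  exists v => //; rewrite inE; apply/andP; split.
    apply/eqP=> v0; move: vP; rewrite v0 inE => /orP[/S'2|/T'2[_]]; rewrite mxE => /eqP.
      by rewrite eq_sym oner_eq0.
    by rewrite eq_sym oner_eq0.
  move: vP; rewrite inE => /orP[]/imsetP[].
    move=> [x y]; rewrite inE /= => xyS ->; have [-> -> ->] := row3E x y 1.
    by rewrite expr1n mulr1.
  move=> y; rewrite inE /= => /eqP yb ->; have [-> -> ->] := row3E 1 y 0.
  by rewrite yb expr1n mulr1 expr0n eqn0Ngt m0 mulr0 addr0 mulrC divfK.
move: vP; rewrite inE -/(on_curve v) => /andP[v0 vC].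
have norm d : d != 0 -> d *: v \in S' :|: T' ->
    exists2 w, w \in S' :|: T' & proj_point v = proj_point w.
  by move=> d0 dv; exists (d *: v) => //; rewrite proj_point_scale.
have [z0|z0] := eqVneq (v 0 (inord 2)) 0; last first.
  apply: (norm (v 0 (inord 2))^-1); rewrite ?invr_eq0 // inE; apply/orP; left.
  move: vC; rewrite -(on_curveZ (v 0 (inord 2))^-1) ?invr_eq0 //.
  set w := _ *: v; have w2 : w 0 (inord 2) = 1 by rewrite mxE mulVf.
  rewrite /on_curve w2 expr1n mulr1 => wS; apply/imsetP.
  by exists (w 0 (inord 0), w 0 (inord 1)); rewrite ?inE // -w2 -row3_eta.
have x0 : v 0 (inord 0) != 0.
  apply: contraNneq v0 => x0; apply/eqP/rowP=> k; rewrite mxE.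
  case/or3P: (ord3E k) => /eqP-> //; move: vC.
  rewrite /on_curve x0 z0 expr0n eqn0Ngt m0 !mulr0 addr0 mulf_eq0 (negbTE a0) /=.
  by rewrite expf_eq0 => /andP[_ /eqP].
apply: (norm (v 0 (inord 0))^-1); rewrite ?invr_eq0 // inE; apply/orP; right.
move: vC; rewrite -(on_curveZ (v 0 (inord 0))^-1) ?invr_eq0 //.
set w := _ *: v; have w0 : w 0 (inord 0) = 1 by rewrite mxE mulVf.
have w2 : w 0 (inord 2) = 0 by rewrite mxE z0 mulr0.
rewrite /on_curve w0 w2 expr1n mulr1 expr0n eqn0Ngt m0 mulr0 addr0 => wC.
apply/imsetP; exists (w 0 (inord 1)); last by rewrite -{1}w0 -w2 -row3_eta.
by rewrite inE -(inj_eq (mulfI a0)) (eqP wC) mulrC divfK.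
Qed.

(** * The number of points in terms of characters *)

Section RootsOfUnitySums.
Variables (m : nat) (al be : algC).
Hypotheses (m_gt0 : (0 < m)%N) (alm : al ^+ m = 1) (bem : be ^+ m = 1).

(** The sum of al^u be^v over the u, v < m such that m divides neither u, nor v,
    nor u + v, in closed form: it is obtained from the sum over all u, v by
    inclusion-exclusion, since any two of the three conditions imply the third. *)
Definition pair_sum : algC :=
  m%:R ^+ 2 * ((al == 1)%:R * (be == 1)%:R)
  - m%:R * ((al == 1)%:R + (be == 1)%:R + (al == be)%:R) + 2.

Lemma sum_dvd_powers (x : algC) : \sum_(u < m) x ^+ u * (m %| u)%:R = 1.
Proof.
rewrite (bigD1 (Ordinal m_gt0)) //= expr0 dvdn0 mulr1 big1 ?addr0 // => u u0.
by rewrite gtnNdvd ?mulr0 // lt0n.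
Qed.

Lemma sum_dvdD_powers :
  \sum_(u < m) \sum_(v < m) al ^+ u * be ^+ v * (m %| u + v)%:R
    = m%:R * (al == be)%:R.
Proof.
have be0 : be != 0.
  by apply/eqP=> be0; move/eqP: bem; rewrite be0 expr0n eqn0Ngt m_gt0 eq_sym oner_eq0.
have -> : (al == be) = (al / be == 1).
  by rewrite -[RHS](inj_eq (mulIf be0)) divfK // mul1r.
rewrite -sum_unity_powers ?expr_div_n ?alm ?bem ?divr1 //; apply: eq_bigr => u _.
have lt_v0 : ((m - u) %% m < m)%N by rewrite ltn_mod.
have um : (m - u + u = m)%N by rewrite subnK // ltnW.
have v0E v : (m %| u + v)%N = (v == (m - u) %[mod m]).
  by rewrite -[v == _ %[mod m]](eqn_modDr u) um modnn /dvdn addnC.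
rewrite (bigD1 (Ordinal lt_v0)) //= v0E modn_mod eqxx mulr1.
rewrite big1 ?addr0 => [|v vv0]; last first.
  rewrite v0E (modn_small (ltn_ord v)); case: eqP => [vE|_]; last by rewrite mulr0.
  by case/eqP: vv0; apply: val_inj.
rewrite expr_div_n; congr (_ * _).
rewrite expr_mod //; apply: (mulIf (expf_neq0 u be0)).
by rewrite -exprD um bem mulVf // expf_neq0.
Qed.

(** Each divisibility condition singles out one u, one v, or one v for each u. *)
Lemma sum_degenerate (A B C : algC) :
  \sum_(u < m) \sum_(v < m) al ^+ u * be ^+ v *
    (A + B * ((m %| u)%:R + (m %| v)%:R + (m %| u + v)%:R)
       + C * ((m %| u)%:R * (m %| v)%:R))
  = A * (m%:R ^+ 2 * ((al == 1)%:R * (be == 1)%:R))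
    + B * (m%:R * ((al == 1)%:R + (be == 1)%:R + (al == be)%:R)) + C.
Proof.
pose dv u : algC := (m %| u)%:R.
transitivity
  (A * \sum_(u < m) \sum_(v < m) al ^+ u * be ^+ v
   + B * (\sum_(u < m) \sum_(v < m) (al ^+ u * dv u) * be ^+ v
          + \sum_(u < m) \sum_(v < m) al ^+ u * (be ^+ v * dv v)
          + \sum_(u < m) \sum_(v < m) al ^+ u * be ^+ v * dv (u + v)%N)
   + C * \sum_(u < m) \sum_(v < m) (al ^+ u * dv u) * (be ^+ v * dv v)).
  rewrite -!big_split !mulr_sumr -!big_split /=; apply: eq_bigr => u _.
  rewrite -!big_split !mulr_sumr -!big_split /=; apply: eq_bigr => v _.
  by rewrite -!/(dv _); ring.
rewrite sum_dvdD_powers -!big_distrlr /= !sum_dvd_powers !sum_unity_powers //.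
ring.
Qed.

End RootsOfUnitySums.

Section CountPoints.
Variables (K : finFieldType) (m : nat) (omega : K) (xi T : algC).
Hypotheses (omega_prim : m.-primitive_root omega) (xi_prim : m.-primitive_root xi).
Local Notation chi := (chi m omega xi).
Local Notation jac := (jac m omega xi).
Hypothesis chiN1 : chi (-1) = 1.
Hypothesis jacT : forall u v,
  ~~ (m %| u)%N -> ~~ (m %| v)%N -> ~~ (m %| u + v)%N -> jac u v = - T.

Let m_gt0 : (0 < m)%N. Proof. exact: prim_order_gt0 omega_prim. Qed.

(** A single formula for the Jacobi sums, degenerate ones included, so that the
    sum over all pairs of exponents can be evaluated at once. *)
Lemma jac_eq u v : jac u v =
  - T + (T - 1) * ((m %| u)%:R + (m %| v)%:R + (m %| u + v)%:R)
      + (#|K|%:R + 1 - 2 * T) * ((m %| u)%:R * (m %| v)%:R).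
Proof.
case: (boolP (m %| u)%N) => mu; case: (boolP (m %| v)%N) => mv.
- by rewrite jac_triv // dvdn_add //=; ring.
- by rewrite jac_half_triv // dvdn_addr // (negbTE mv) /=; ring.
- by rewrite jacC jac_half_triv // dvdn_addl // (negbTE mu) /=; ring.
case: (boolP (m %| u + v)%N) => muv; first by rewrite jac_opp //=; ring.
by rewrite jacT //=; ring.
Qed.

Let nu x := #|[set y : K | y ^+ m == x]|.

(** Sort the points by w = a y^m / c; then 1 - w = - b x^m / c. *)
Lemma card_affine_diag (a b c : K) : a != 0 -> b != 0 -> c != 0 ->
  #|[set p : K * K | a * p.2 ^+ m == b * p.1 ^+ m + c]| =
  (\sum_(w : K) nu (w * (c / a))%R * nu ((w - 1) * (c / b))%R)%N.
Proof.
move=> a0 b0 c0.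
rewrite -sum1_card (partition_big (fun p : K * K => a * p.2 ^+ m / c) predT) //=.
apply: eq_bigr => w _; rewrite sum1_card mulnC -cardsX; apply: eq_card => -[x y].
rewrite -[LHS]/((_ \in _) && _) !inE /=; apply/andP/andP => -[/eqP e1 /eqP e2].
  split; apply/eqP; rewrite -e2; last by field; rewrite a0 c0.
  by rewrite e1; field; rewrite b0 c0.
split; apply/eqP; rewrite e2 ?e1; field; rewrite ?a0 ?b0 ?c0 //.
Qed.

(** The number of m-th roots of x != 0 is the sum of the chi(x)^u.  The contributions
    of w = 0, w = 1 and of the points at infinity cancel against those of the
    degenerate Jacobi sums. *)
Lemma card_proj_diag_pair_sum (a b c : K) : a != 0 -> b != 0 -> c != 0 ->
  #|[set proj_point v | v : 'rV[K]_3 & (v != 0) &&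
      (a * v 0 (inord 1) ^+ m == b * v 0 (inord 0) ^+ m + c * v 0 (inord 2) ^+ m)]|%:R
  = #|K|%:R + 1 - T * pair_sum m (chi (c / a)) (chi (c / b)).
Proof.
move=> a0 b0 c0; rewrite card_proj_diag // card_affine_diag // natrD natr_sum.
have [ca0 cb0 ba0] : [/\ c / a != 0, c / b != 0 & b / a != 0].
  by rewrite !mulf_neq0 ?invr_eq0.
have nuE x : x != 0 -> (nu x)%:R = \sum_(u < m) chi x ^+ u.
  by move=> x0; rewrite sum_unity_powers ?chi_unity // -(card_roots omega_prim xi_prim x0).
have nu0 : nu 0 = 1%N.
  rewrite /nu -(cards1 (0 : K)); apply: eq_card => y; rewrite !inE.
  by rewrite expf_eq0 m_gt0.
rewrite (bigD1 0) // (bigD1 1) ?oner_eq0 //= mul0r mul1r subrr mul0r sub0r nu0.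
set al := chi (c / a); set be := chi (c / b).
have chiNcb : chi (-1 * (c / b)) = be.
  by rewrite (chiM omega_prim xi_prim) ?oppr_eq0 ?oner_eq0 // chiN1 mul1r.
rewrite mul1n muln1 (card_roots omega_prim xi_prim ba0).
have -> : (nu (-1 * (c / b)))%:R = m%:R * (be == 1)%:R :> algC.
  by rewrite nuE ?sum_unity_powers ?chi_unity ?chiNcb // mulf_neq0 ?oppr_eq0 ?oner_eq0.
have -> : (nu (c / a))%:R = m%:R * (al == 1)%:R :> algC.
  by rewrite nuE ?sum_unity_powers ?chi_unity.
have -> : (chi (b / a) == 1) = (al == be).
  have -> : b / a = (c / a) / (c / b) by field; rewrite a0 b0 c0.
  have be0 : be != 0 := chi_neq0 omega_prim xi_prim _.
  rewrite (chiM omega_prim xi_prim) ?invr_eq0 // (chiV omega_prim xi_prim) //.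
  by rewrite -[LHS](inj_eq (mulIf be0)) divfK // mul1r.
have -> : \sum_(w | (w != 0) && (w != 1)) (nu (w * (c / a))%R * nu ((w - 1) * (c / b))%R)%:R
   = \sum_(u < m) \sum_(v < m) al ^+ u * be ^+ v * jac u v :> algC.
  under [RHS]eq_bigr => u _ do under eq_bigr => v _ do rewrite /jac mulr_sumr.
  under [RHS]eq_bigr => u _ do rewrite exchange_big.
  rewrite [RHS]exchange_big; apply: eq_bigr => w /andP[w0 w1].
  have w1' : 1 - w != 0 by rewrite subr_eq0 eq_sym.
  have -> : (w - 1) * (c / b) = (1 - w) * (-1 * (c / b)) by ring.
  have cbN0 : -1 * (c / b) != 0 by rewrite mulf_neq0 ?oppr_eq0 ?oner_eq0.
  rewrite natrM (nuE _ (mulf_neq0 w0 ca0)) (nuE _ (mulf_neq0 w1' cbN0)).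
  rewrite big_distrlr; apply: eq_bigr => u _; apply: eq_bigr => v _ /=.
  rewrite (chiM omega_prim xi_prim w0 ca0) (chiM omega_prim xi_prim w1' cbN0).
  by rewrite chiNcb -/al !exprMn; ring.
under eq_bigr => u _ do under eq_bigr => v _ do rewrite jac_eq.
rewrite sum_degenerate ?chi_unity // /pair_sum; ring.
Qed.
End CountPoints.

(** * Characters over an extension field *)

(** p^f = 1 mod l and l is prime, so p^(f/2) is 1 or -1 mod l, and the minimality
    of f excludes 1. *)
Lemma semiprimitive_half_order p l f :
  is_ord p l f -> ~~ odd f -> odd p -> prime l -> odd l ->
  (2 * l %| (p ^ f./2).+1)%N.
Proof.
move=> [f_gt0 pf1 f_min] f_even p_odd l_prime l_odd.
rewrite Gauss_dvd ?coprime2n // dvdn2 /= oddX p_odd orbT /=.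
have f2 : f = (f./2 * 2)%N by rewrite muln2 even_halfK.
have half_gt0 : (0 < f./2)%N by move: f_gt0 f2; lia.
have e_gt0 : (0 < p ^ f./2)%N by rewrite expn_gt0 (odd_gt0 p_odd).
have : (l %| (p ^ f./2 - 1) * (p ^ f./2 + 1))%N.
  by rewrite -subn_sqr -expnM -f2 exp1n -eqn_mod_dvd ?expn_gt0 ?(odd_gt0 p_odd) //; apply/eqP.
rewrite Euclid_dvdM // addn1 -eqn_mod_dvd // => /orP[/eqP/(f_min _ half_gt0)|//].
by move: f_gt0 f2; lia.
Qed.

Lemma card_finvect (F : finFieldType) (L : fieldExtType F) :
  #|finvect_type L| = (#|F| ^ \dim {: L})%N.
Proof.
pose cT := Vector.class (finvect_type L : vectType F).
by rewrite -(card_vspacef cT) card_vspace.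
Qed.

Lemma generator_prim_root (F : finFieldType) (g : {unit F}) :
  generator [set: {unit F}] g -> #|F|.-1.-primitive_root (FinRing.uval g).
Proof.
move=> gP; have gN k : (FinRing.uval g ^+ k == 1) = (#|F|.-1 %| k)%N.
  rewrite -card_finField_unit (eqP gP) order_dvdn -(FinRing.val_unitX k g).
  by rewrite -val_eqE.
have N_gt0 : (0 < #|F|.-1)%N by have := card_finNzRing_gt1 F; case: #|F| => [|[]].
have [d d_prim dN] := prim_order_exists N_gt0 (eqP (etrans (gN _) (dvdnn _))).
suff -> : #|F|.-1 = d by [].
by apply/eqP; rewrite eqn_dvd dN -gN (prim_expr_order d_prim) eqxx.
Qed.

Section FieldExtensionCharacter.
Variables (F K : finFieldType) (h : {rmorphism F -> K}) (m n : nat) (g : F) (xi : algC).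
Hypotheses (g_prim : #|F|.-1.-primitive_root g) (m_dvd : (m %| #|F|.-1)%N).
Hypotheses (xi_prim : m.-primitive_root xi) (cardK : #|K| = (#|F| ^ n)%N).

Definition ext_root : K := h (g ^+ (#|F|.-1 %/ m)).

Lemma ext_root_prim : m.-primitive_root ext_root.
Proof. by rewrite fmorph_primitive_root; apply: dvdn_prim_root. Qed.

(** (q^n - 1) / m = ((q - 1) / m) (1 + q + ... + q^(n-1)), and the last factor is n
    mod m since q = 1 mod m. *)
Lemma chi_ext k : chi m ext_root xi (h (g ^+ k)) = xi ^+ (n * k).
Proof.
pose S := (\sum_(t < n) #|F| ^ t)%N.
have cardN : #|K|.-1 = (#|F|.-1 * S)%N by rewrite cardK predn_exp.
have SE : (S = n %[mod m])%N.
  rewrite -[in RHS](card_ord n) -sum1_card /S -[LHS]modn_summ -[RHS]modn_summ.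
  congr (_ %% _)%N; apply: eq_bigr => t _; rewrite -modnXm.
  suff -> : (#|F| = 1 %[mod m])%N by rewrite modnXm exp1n.
  by apply/eqP; rewrite eqn_mod_dvd ?subn1 // ltnW // card_finNzRing_gt1.
rewrite (@chiE _ _ _ _ ext_root_prim xi_prim _ (S * k)).
  by apply/eqP; rewrite (eq_prim_root_expr xi_prim) -modnMml SE modnMml.
rewrite cardN /ext_root -!rmorphXn -!exprM; congr (h (g ^+ _)).
by rewrite -divn_mulAC // mulnC mulnA.
Qed.

Lemma chi_ext_N1 : (2 * m %| #|K|.-1)%N -> chi m ext_root xi (-1) = 1.
Proof.
move=> /dvdnP[t tE]; rewrite (@chiE _ _ _ _ ext_root_prim xi_prim _ 0) ?expr0 //.
have m_gt0 := prim_order_gt0 xi_prim.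
by rewrite tE mulnA mulnK // mulnC exprM sqrrN !expr1n.
Qed.
End FieldExtensionCharacter.

(** * The curve over the extensions of the base field *)

Lemma diag_curve_eval (F : finFieldType) (L : fieldExtType F) m (a b c : F)
    (v : 'rV[finvect_type L]_3) :
  (map_mpoly (in_alg (finvect_type L)) (diag_curve m a b c)).@[fun k => v 0 k] =
  a%:A * v 0 (inord 1) ^+ m
    - (b%:A * v 0 (inord 0) ^+ m + c%:A * v 0 (inord 2) ^+ m).
Proof.
rewrite /diag_curve !(rmorphB, rmorphD) /= -!mul_mpolyC !(rmorphM, rmorphXn) /=.
by rewrite !map_mpolyC /= !map_mpolyX !mevalC !mevalXU.
Qed.

(** This makes -1 an m-th power in the fields with r^2 elements. *)
Lemma dvd_4l_sqr_pred l r : prime l -> odd l -> odd r -> (l %| (r ^ 2).-1)%N ->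
  (2 * (2 * l) %| (r ^ 2).-1)%N.
Proof.
move=> l_prime l_odd r_odd lr; rewrite mulnA Gauss_dvd ?lr ?andbT; last first.
  by rewrite coprimeMl coprime2n l_odd.
rewrite -[r]odd_double_half r_odd -subn1 add1n -mul2n.
have -> : ((2 * r./2).+1 ^ 2 - 1 = 2 * 2 * (r./2 * (r./2).+1))%N by nia.
exact: dvdn_mulr.
Qed.

Section FermatCurve.
Variables (p l f s q : nat).
Hypotheses (p_prime : prime p) (p_odd : odd p) (l_prime : prime l) (l_odd : odd l).
Hypotheses (f_ord : is_ord p l f) (f_even : ~~ odd f) (qE : q = (p ^ (f * s))%N).
Variables (F : finFieldType) (cardF : #|F| = q) (E : nat -> fieldExtType F).
Hypothesis dimE : forall n : nat, (0 < n)%N -> \dim {: E n} = n.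
Variables (a b c : F) (g : F) (i j : nat) (xi : algC).
Hypotheses (a0 : a != 0) (b0 : b != 0) (c0 : c != 0).
Hypotheses (g_prim : #|F|.-1.-primitive_root g) (xi_prim : (2 * l)%N.-primitive_root xi).
Hypotheses (cbE : c / b = g ^+ i) (caE : c / a = g ^+ j).

Let m := (2 * l)%N.
Let theta : algC := (-1) ^+ s * sqrtC q%:R.

Let Q := (p ^ f./2)%N.
Let qE2 : q = ((Q ^ s) ^ 2)%N.
Proof. by rewrite qE -!expnM mulnCA muln2 even_halfK // mulnC. Qed.

Let thetaE : theta = (-1) ^+ s * Q%:R ^+ s.
Proof. by rewrite /theta qE2 natrX sqrCK ?ler0n // natrX. Qed.

Let m_dvdQ : (m %| Q.+1)%N.
Proof. exact: semiprimitive_half_order f_ord f_even p_odd l_prime l_odd. Qed.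

Let l_dvdQ : (l %| Q.+1)%N.
Proof. by apply: dvdn_trans m_dvdQ; rewrite dvdn_mull. Qed.

Let Q_modl k : ((Q ^ k)%N%:Z = (-1) ^+ k %[mod l])%Z.
Proof.
elim: k => [|k IH]; first by rewrite expn0 expr0.
rewrite expnS PoszM exprS -modzMm IH.
suff /eqP-> : (Q == -1 %[mod l])%Z by rewrite modzMm.
by rewrite eqz_mod_dvd opprK dvdzE /= addn1.
Qed.

Let Qk_sqr k : (2 * m %| ((Q ^ k) ^ 2).-1)%N.
Proof.
apply: dvd_4l_sqr_pred => //; first by rewrite !oddX p_odd !orbT.
rewrite -expnM mulnC expnM predn_exp dvdn_mulr // -subn1 -(exp1n 2) subn_sqr addn1.
exact: dvdn_mull.
Qed.

Lemma dvd_card_pred : (m %| #|F|.-1)%N.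
Proof. by rewrite cardF qE2; apply: dvdn_trans (Qk_sqr s); rewrite dvdn_mull. Qed.

Lemma card_fermat_curve n : (0 < n)%N ->
  #|curve_points (diag_curve m a b c) (E n)|%:R =
  q%:R ^+ n + 1 - theta ^+ n * pair_sum m (xi ^+ (n * j)) (xi ^+ (n * i)) :> algC.
Proof.
move=> n_gt0; set K : finFieldType := finvect_type (E n).
pose h : {rmorphism F -> K} := in_alg (finvect_type (E n)).
have cardK : #|K| = (#|F| ^ n)%N by rewrite card_finvect dimE.
have cardK2 : #|K| = ((Q ^ (s * n)) ^ 2)%N.
  by rewrite cardK cardF qE2 (expnAC _ 2 n) -(expnM Q s n).
have m_dvd := dvd_card_pred.
have om_prim := ext_root_prim h g_prim m_dvd.
have pK : p \in [pchar K].
  by apply: (@card_finPcharP _ _ (f * s * n)) => //; rewrite cardK cardF qE -expnM.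
have chiN1 : chi m (ext_root h m g) xi (-1) = 1.
  by apply: chi_ext_N1 => //; rewrite cardK2.
have jacT u v : ~~ (m %| u)%N -> ~~ (m %| v)%N -> ~~ (m %| u + v)%N ->
    jac m (ext_root h m g) xi u v = - theta ^+ n.
  move=> mu mv muv.
  rewrite (jac_semiprimitive l_prime l_odd om_prim xi_prim chiN1 pK m_dvdQ cardK2
    (Q_modl (s * n)) mu mv muv) mulNr thetaE.
  by rewrite exprMn natrX -!exprM.
have := card_proj_diag_pair_sum om_prim xi_prim chiN1 jacT (a := h a) (b := h b) (c := h c).
rewrite !fmorph_eq0 => /(_ a0 b0 c0).
rewrite -!fmorph_div caE cbE !(chi_ext h g_prim dvd_card_pred xi_prim cardK).
rewrite cardK cardF natrX => <-; congr (#|pred_of_set _|%:R); rewrite /curve_points.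
by apply/setP=> B; apply/imsetP/imsetP => -[v vP ->]; exists v => //;
  move: vP; rewrite !inE diag_curve_eval subr_eq0.
Qed.

End FermatCurve.

(** * Products over roots of unity *)

Lemma sum_prim_root_powers (d n : nat) (z : algC) : d.-primitive_root z ->
  \sum_(1 <= r < d) (z ^+ r) ^+ n = d%:R * (d %| n)%:R - 1.
Proof.
move=> z_prim; have d_gt0 := prim_order_gt0 z_prim.
rewrite (prim_order_dvd z_prim) -(@sum_unity_powers _ d (z ^+ n)); last first.
  by rewrite exprAC (prim_expr_order z_prim) expr1n.
rewrite -(big_mkord predT (fun u => (z ^+ n) ^+ u)) (big_ltn d_gt0) expr0 addrAC subrr add0r.
by apply: eq_bigr => r _; rewrite exprAC.
Qed.

Lemma has_logder_pair (K : numFieldType) N (w : K) e1 e2 :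
  has_logder N ((1 - w *: 'X) ^+ e1 * (1 + w *: 'X) ^+ e2)
    (fun n => - w ^+ n * (e1%:R + e2%:R * (-1) ^+ n)).
Proof.
have d1 := has_logderX e1 (has_logder_linear N w).
have d2 := has_logderX e2 (has_logder_linear N (- w)).
rewrite scaleNr opprK in d2; apply: has_logder_ext (has_logderM d1 d2) => n _.
by rewrite (exprNn w); ring.
Qed.

Lemma has_logder_root_prod N (d e1 e2 : nat) (z w : algC) : d.-primitive_root z ->
  has_logder N
    (\prod_(1 <= r < d) ((1 - (z ^+ r * w) *: 'X) ^+ e1 * (1 + (z ^+ r * w) *: 'X) ^+ e2))
    (fun n => - w ^+ n * ((e1%:R + e2%:R * (-1) ^+ n) * (d%:R * (d %| n)%:R - 1))).
Proof.
move=> z_prim.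
apply: has_logder_ext (has_logder_prod _ (fun r _ => has_logder_pair N (z ^+ r * w) e1 e2)).
move=> n _; rewrite -(sum_prim_root_powers n z_prim) !mulr_sumr.
by apply: eq_bigr => r _; rewrite exprMn; ring.
Qed.

(** All the shapes that occur for the numerator of the zeta function. *)
Definition cyclo_poly (l e1 e2 e3 e4 : nat) (z w : algC) : {poly algC} :=
  (1 - w *: 'X) ^+ e1 * (1 + w *: 'X) ^+ e2 *
  \prod_(1 <= r < l) ((1 - (z ^+ r * w) *: 'X) ^+ e3 * (1 + (z ^+ r * w) *: 'X) ^+ e4).

Lemma has_logder_cyclo_poly N l e1 e2 e3 e4 z w : l.-primitive_root z ->
  has_logder N (cyclo_poly l e1 e2 e3 e4 z w)
    (fun n => - w ^+ n * (e1%:R + e2%:R * (-1) ^+ n +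
       (e3%:R + e4%:R * (-1) ^+ n) * (l%:R * (l %| n)%:R - 1))).
Proof.
move=> z_prim; apply: has_logder_ext
  (has_logderM (has_logder_pair N w e1 e2) (has_logder_root_prod N e3 e4 w z_prim)).
by move=> n _; ring.
Qed.

(** The numerator of the zeta function for arbitrary indices. *)
Definition jacobi_poly m (al be w : algC) : {poly algC} :=
  \prod_(u < m) \prod_(v < m | ~~ [|| m %| u, m %| v | m %| u + v]%N)
    (1 - (al ^+ u * be ^+ v * w) *: 'X).

Lemma has_logder_jacobi_poly N m (al be w : algC) :
  (0 < m)%N -> al ^+ m = 1 -> be ^+ m = 1 ->
  has_logder N (jacobi_poly m al be w)
    (fun n => - w ^+ n * pair_sum m (al ^+ n) (be ^+ n)).
Proof.
move=> m_gt0 alm bem; have dlin (u v : 'I_m) := has_logder_linear N (al ^+ u * be ^+ v * w).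
have dprod (u : 'I_m) : has_logder N
    (\prod_(v < m | ~~ [|| m %| u, m %| v | m %| u + v]%N)
      (1 - (al ^+ u * be ^+ v * w) *: 'X)) _ := has_logder_prod _ (fun v _ => dlin u v).
apply: has_logder_ext (has_logder_prod _ (fun u _ => dprod u)).
move=> n _; have alnm : (al ^+ n) ^+ m = 1 by rewrite exprAC alm expr1n.
have benm : (be ^+ n) ^+ m = 1 by rewrite exprAC bem expr1n.
have -> : pair_sum m (al ^+ n) (be ^+ n) =
  \sum_(u < m) \sum_(v < m) (al ^+ n) ^+ u * (be ^+ n) ^+ v *
    (1 + (-1) * ((m %| u)%:R + (m %| v)%:R + (m %| u + v)%:R)
       + 2 * ((m %| u)%:R * (m %| v)%:R)).
  by rewrite sum_degenerate // /pair_sum; ring.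
rewrite mulr_sumr; apply: eq_bigr => u _; rewrite mulr_sumr big_mkcond.
apply: eq_bigr => v _; rewrite 2!(exprAC _ n) !exprMn.
case: (boolP (m %| u)%N) => mu; case: (boolP (m %| v)%N) => mv /=.
- by rewrite dvdn_add //=; ring.
- by rewrite dvdn_addr // (negbTE mv) /=; ring.
- by rewrite dvdn_addl // (negbTE mu) /=; ring.
by case: (m %| u + v)%N => /=; ring.
Qed.

(** * Divisibility by twice an odd prime *)

(** Written with exclusive or, which computes on booleans. *)
Lemma dvdz2B (x y : int) : (2 %| x - y)%Z = ~~ ((2 %| x)%Z (+) (2 %| y)%Z).
Proof. by lia. Qed.

Section BooleanForm.
Variable l : nat.
Hypotheses (l_prime : prime l) (l_odd : odd l).
Let m := (2 * l)%N.
Implicit Types (x y : int) (i j : nat).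

Lemma dvdz_twice_prime x : (m%:Z %| x)%Z = (l %| x)%Z && (2 %| x)%Z.
Proof. by rewrite !dvdzE /= Gauss_dvd ?coprime2n // andbC. Qed.

Lemma odd_primez_not_even : (2 %| l%:Z)%Z = false.
Proof. by rewrite dvdzE /= dvdn2 l_odd. Qed.

Lemma eqz_mod0 x : (x == 0 %[mod m])%Z = (l %| x)%Z && (2 %| x)%Z.
Proof. by rewrite eqz_mod_dvd subr0 dvdz_twice_prime. Qed.

Lemma eqz_modl x : (x == l%:Z %[mod m])%Z = (l %| x)%Z && ~~ (2 %| x)%Z.
Proof.
rewrite eqz_mod_dvd dvdz_twice_prime dvdz2B odd_primez_not_even addbF.
by rewrite (rpredBr _ (dvdzz l)).
Qed.

(** Whether 2l divides n x, when A and B tell whether l and 2 divide n. *)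
Definition dvd_twice (A B : bool) x := (A || (l %| x)%Z) && (B || (2 %| x)%Z).

Lemma dvd_twiceE n x : (m%:Z %| n%:Z * x)%Z = dvd_twice (l %| n)%N (2 %| n)%N x.
Proof.
by rewrite dvdz_twice_prime /dvd_twice !dvdzE !abszM /= !Euclid_dvdM.
Qed.

(** [pair_sum] at the n-th powers of the roots of unity of indices - y and - x, in
    terms of the divisibility of n by l (A) and by 2 (B). *)
Definition pair_sum_at x y (A B : bool) : algC :=
  (2 * l)%N%:R ^+ 2 * ((dvd_twice A B y)%:R * (dvd_twice A B x)%:R)
  - (2 * l)%N%:R * ((dvd_twice A B y)%:R + (dvd_twice A B x)%:R
     + (dvd_twice A B (x - y))%:R) + 2.

Lemma pair_sum_atE (xi : algC) i j x y n : m.-primitive_root xi ->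
  (m%:Z %| i%:Z + x)%Z -> (m%:Z %| j%:Z + y)%Z ->
  pair_sum m (xi ^+ (n * j)) (xi ^+ (n * i)) = pair_sum_at x y (l %| n)%N (2 %| n)%N.
Proof.
move=> xi_prim ix jy.
have dvd_n k z : (m%:Z %| k%:Z + z)%Z -> (m%:Z %| n%:Z * (k%:Z + z))%Z.
  exact: dvdz_mull.
have dvdE k z : (m%:Z %| k%:Z + z)%Z -> (m %| n * k)%N = (m%:Z %| n%:Z * z)%Z.
  move=> /dvd_n kz; rewrite -(rpredBl _ kz) mulrDr addrK.
  by rewrite -PoszM dvdzE.
have eqE : (xi ^+ (n * j) == xi ^+ (n * i)) = (m%:Z %| n%:Z * (x - y))%Z.
  rewrite (eq_prim_root_expr xi_prim) -eqz_nat -!modz_nat eqz_mod_dvd.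
  rewrite -(rpredDl _ (rpredB (dvd_n _ _ ix) (dvd_n _ _ jy))).
  by congr (dvdz _ _); rewrite !PoszM; ring.
by rewrite /pair_sum -!(prim_order_dvd xi_prim) eqE (dvdE _ _ ix) (dvdE _ _ jy) !dvd_twiceE.
Qed.
End BooleanForm.

(** * Indices *)

Lemma prim_root_exprz (K : fieldType) N (g : K) (k : int) :
  N.-primitive_root g -> exists2 k' : nat, g ^ k = g ^+ k' & (N %| k'%:Z - k)%Z.
Proof.
move=> g_prim; have N_gt0 := prim_order_gt0 g_prim.
have g0 : g != 0.
  apply/eqP=> g0; move/eqP: (prim_expr_order g_prim).
  by rewrite g0 expr0n eqn0Ngt N_gt0 eq_sym oner_eq0.
have k_ge0 : 0 <= (k %% N)%Z by rewrite modz_ge0 // -lt0n.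
exists `|(k %% N)%Z|%N; last by rewrite gez0_abs // -eqz_mod_dvd modz_mod.
rewrite {1}(divz_eq k N) expfzDr // (mulrC _ N%:Z) -exprz_exp -exprnP.
by rewrite (prim_expr_order g_prim) exp1rz mul1r exprnP gez0_abs.
Qed.

(** The character sums involve c / b and c / a, whose indices are - i and - j, and
    exponents that are natural numbers. *)
Lemma index_inverse (F : finFieldType) (g : {unit F}) m (x y : F) (i : int) :
  #|F|.-1.-primitive_root (FinRing.uval g) -> (m %| #|F|.-1)%N ->
  (exists2 k : int, is_ind g (x / y) k & (k = i %[mod m%:Z])%Z) ->
  exists2 i' : nat, y / x = FinRing.uval g ^+ i' & (m%:Z %| i'%:Z + i)%Z.
Proof.
move=> g_prim m_dvd [k gk /eqP ki]; have [i' gi' i'k] := prim_root_exprz (- k) g_prim.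
exists i'; first by rewrite -gi' -invr_expz gk invf_div.
rewrite eqz_mod_dvd in ki.
have -> : i'%:Z + i = (i'%:Z - (- k)) - (k - i) by ring.
by apply: rpredB => //; apply: dvdz_trans i'k; rewrite dvdzE.
Qed.

(** * The zeta function *)

(** Proves an identity between power sums that depend on whether l and 2 divide
    n, i, j and i - j.  The congruences in H are replaced by propositional
    variables, which [table] relates to the divisibilities of i, j and i - j; the
    combinations excluded by H are refuted, and the identity is checked by
    computation in the others. *)
Ltac decide_residues i j l m L table H :=
  let A := fresh "A" in let B := fresh "B" in
  move=> A B; rewrite /pair_sum_at /dvd_twice dvdz2B ?natrM;
  move: table H; rewrite dvdz2B;
  generalize (i = 0 %[mod m])%Z (j = 0 %[mod m])%Z (i - j = 0 %[mod m])%Z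
    (i = L %[mod m])%Z (j = L %[mod m])%Z (i - j = L %[mod m])%Z
    (i = j %[mod m])%Z (i = 0 %[mod 2])%Z (j = 0 %[mod 2])%Z (i = j %[mod 2])%Z;
  case: (l %| i)%Z; case: (l %| j)%Z; case: (l %| i - j)%Z;
  case: (2 %| i)%Z; case: (2 %| j)%Z => /=;
  repeat (let h := fresh "h" in move=> h);
  repeat match goal with
  | h : _ /\ _ |- _ => destruct h
  | h : ?R <-> is_true true |- _ => pose proof (proj2 h isT); clear h
  | h : ?R <-> is_true false |- _ => pose proof (fun r : R => notF (proj1 h r)); clear h
  | h : is_true true -> _ |- _ => pose proof (h isT); clear h
  end;
  try discriminate; try by [exfalso; tauto];
  case: A; case: B => /=; ring.

Theorem theorem1 (p l f s q : nat)
  (hp : prime p) (hp2 : odd p) (hl : prime l) (hl2 : odd l)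
  (hpl : coprime p l) (hf : is_ord p l f) (hf2 : ~~ odd f)
  (hs : (1 <= s)%N) (hq : q = (p ^ (f * s))%N)
  (F : finFieldType) (hF : #|F| = q)
  (E : nat -> fieldExtType F)
  (hE : forall n : nat, (0 < n)%N -> \dim {: E n} = n)
  (a b c : F) (habc : a * b * c != 0)
  (gamma : {unit F}) (hgamma : generator [set: {unit F}] gamma)
  (i j : int)
  (hi : exists2 k : int, is_ind gamma (b / c) k & (k = i %[mod (2 * l)%N%:Z])%Z)
  (hj : exists2 k : int, is_ind gamma (a / c) k & (k = j %[mod (2 * l)%N%:Z])%Z)
  (zeta_l : algC) (hzeta : l.-primitive_root zeta_l)
  (xi : algC) (hxi : (2 * l)%N.-primitive_root xi) :
  let m : int := (2 * l)%N%:Z in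
  let L : int := l%:Z in
  let theta : algC := (-1) ^+ s * sqrtC q%:R in
  exists P : {poly algC},
    fps_is_fraction (zeta (diag_curve (2 * l) a b c) E)
      P ((1 - 'X) * (1 - q%:R *: 'X)) /\
    (* 1 *)
    ((i = 0 %[mod m])%Z /\ (j = 0 %[mod m])%Z ->
      P = (1 - theta *: 'X) ^+ ((2 * l - 1) * (2 * l - 2))) /\
    (* 2 *)
    ((i = 0 %[mod 2])%Z /\ (j = 0 %[mod 2])%Z /\
     (i <> 0 %[mod m])%Z /\ (j <> 0 %[mod m])%Z /\ (i - j <> 0 %[mod m])%Z ->
      P = (1 - theta *: 'X) ^+ (4 * l - 4) *
          \prod_(1 <= r < l) (1 - (zeta_l ^+ r * theta) *: 'X) ^+ (4 * l - 6)) /\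
    (* 3 *)
    ((i = 0 %[mod 2])%Z /\ (j = 0 %[mod 2])%Z /\
     ((i = 0 %[mod m])%Z /\ (j <> 0 %[mod m])%Z \/
      (i <> 0 %[mod m])%Z /\ (j = 0 %[mod m])%Z \/
      (i <> 0 %[mod m])%Z /\ (j <> 0 %[mod m])%Z /\ (i = j %[mod m])%Z) ->
      P = (1 - theta *: 'X) ^+ (2 * l - 2) *
          \prod_(1 <= r < l) (1 - (zeta_l ^+ r * theta) *: 'X) ^+ (4 * l - 4)) /\
    (* 4 *)
    ((i = 0 %[mod m])%Z /\ (j = L %[mod m])%Z \/
     (i = L %[mod m])%Z /\ (j = 0 %[mod m])%Z \/
     (i = j %[mod m])%Z /\ (j = L %[mod m])%Z ->
      P = (1 - theta *: 'X) ^+ (2 * (l - 1) ^ 2) *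
          (1 + theta *: 'X) ^+ (2 * l * (l - 1))) /\
    (* 5 *)
    ((j <> 0 %[mod 2])%Z /\ (i = 0 %[mod m])%Z /\ (j <> L %[mod m])%Z \/
     (i <> 0 %[mod 2])%Z /\ (i <> L %[mod m])%Z /\ (j = 0 %[mod m])%Z \/
     (i <> 0 %[mod 2])%Z /\ (i = j %[mod m])%Z /\ (i <> L %[mod m])%Z ->
      P = (1 + theta *: 'X) ^+ (2 * l - 2) *
          \prod_(1 <= r < l) ((1 - (zeta_l ^+ r * theta) *: 'X) *
                              (1 + (zeta_l ^+ r * theta) *: 'X)) ^+ (2 * l - 2) /\
      P = \prod_(1 <= r < 2 * l) (1 - (xi ^+ r * theta) *: 'X) ^+ (2 * l - 2)) /\
    (* 6 *)
    (((i <> 0 %[mod m])%Z /\ (i <> L %[mod m])%Z /\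
      (j <> 0 %[mod m])%Z /\ (j <> L %[mod m])%Z /\
      (i - j <> 0 %[mod m])%Z /\ (i - j <> L %[mod m])%Z) /\
     ((i <> j %[mod 2])%Z \/
      (i <> 0 %[mod 2])%Z /\ (j <> 0 %[mod 2])%Z) ->
      P = ((1 - theta *: 'X) * (1 + theta *: 'X)) ^+ (2 * l - 2) *
          \prod_(1 <= r < l)
            ((1 - (zeta_l ^+ r * theta) *: 'X) ^+ (2 * l - 4) *
             (1 + (zeta_l ^+ r * theta) *: 'X) ^+ (2 * l - 2))) /\
    (* 7 *)
    ((i = L %[mod m])%Z /\ ((j <> 0 %[mod m])%Z /\ (j <> L %[mod m])%Z) \/
     ((i <> 0 %[mod m])%Z /\ (i <> L %[mod m])%Z) /\ (j = L %[mod m])%Z \/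
     ((i <> 0 %[mod m])%Z /\ (i <> L %[mod m])%Z) /\
     ((j <> 0 %[mod m])%Z /\ (j <> L %[mod m])%Z) /\ (i - j = L %[mod m])%Z ->
      P = ((1 - theta *: 'X) * (1 + theta *: 'X)) ^+ (l - 1) *
          \prod_(1 <= r < l)
            ((1 - (zeta_l ^+ r * theta) *: 'X) ^+ (2 * l - 3) *
             (1 + (zeta_l ^+ r * theta) *: 'X) ^+ (2 * l - 1))).
Proof.
move=> m L theta.
have l_gt2 : (2 < l)%N by move: (prime_gt1 hl) hl2; lia.
have m_gt0 : (0 < 2 * l)%N by rewrite muln_gt0 (ltnW (ltnW l_gt2)).
have [a0 b0 c0] : [/\ a != 0, b != 0 & c != 0].
  by move: habc; rewrite !mulf_eq0 !negb_or -andbA => /and3P[].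
pose g := FinRing.uval gamma.
have g_prim : #|F|.-1.-primitive_root g := generator_prim_root hgamma.
have m_dvd : (2 * l %| #|F|.-1)%N := dvd_card_pred hp2 hl hl2 hf hf2 hq hF.
have [i' cbE i'i] := index_inverse g_prim m_dvd hi.
have [j' caE j'j] := index_inverse g_prim m_dvd hj.
pose P := jacobi_poly (2 * l) (xi ^+ j') (xi ^+ i') theta.
have P_logder N : has_logder N P
    (fun n => - theta ^+ n * pair_sum (2 * l) (xi ^+ (n * j')) (xi ^+ (n * i'))).
  apply: has_logder_ext (has_logder_jacobi_poly N theta m_gt0 _ _) => [n _||].
  - by rewrite -!exprM !(mulnC n).
  - by rewrite exprAC (prim_expr_order hxi) expr1n.
  - by rewrite exprAC (prim_expr_order hxi) expr1n.
(* The power sums of P for the exponent n only depend on whether l and 2 divide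
   n; matching them for the four possibilities identifies P. *)
have P_eq R (v : bool -> bool -> algC) :
    (forall N, has_logder N R (fun n => - theta ^+ n * v (l %| n)%N (2 %| n)%N)) ->
    (forall A B, v A B = pair_sum_at l i j A B) -> P = R.
  move=> R_logder vE; apply: (has_logder_eq P_logder) => N.
  apply: has_logder_ext (R_logder N) => n _.
  by rewrite (pair_sum_atE hl hl2 n hxi i'i j'j) -vE.
have P_cyclo (e1 e2 e3 e4 : nat) :
    (forall A B : bool, e1%:R + e2%:R * (-1) ^+ (~~ B) +
       (e3%:R + e4%:R * (-1) ^+ (~~ B)) * (l%:R * A%:R - 1) = pair_sum_at l i j A B :> algC) ->
    P = cyclo_poly l e1 e2 e3 e4 zeta_l theta.
  apply: P_eq => N.
  apply: has_logder_ext (has_logder_cyclo_poly N e1 e2 e3 e4 theta hzeta) => n _.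
  by rewrite dvdn2 negbK signr_odd.
(* The inverse roots of the denominator are 1 and q, of power sum 1 + q^n. *)
exists P; split.
  have Q_logder N : has_logder N ((1 - 'X) * (1 - q%:R *: 'X) : {poly algC})
      (fun n => - 1 ^+ n + - q%:R ^+ n).
    by rewrite -{1}['X]scale1r; apply: has_logderM; apply: has_logder_linear.
  apply: (fps_exp_fraction _ _ P_logder Q_logder) => [//|n n_gt0].
  case: n n_gt0 => // n _; rewrite mulrC divfK ?pnatr_eq0 //.
  rewrite (card_fermat_curve hp hp2 hl hl2 hf hf2 hq hF hE a0 b0 c0 g_prim hxi cbE caE) //.
  by rewrite expr1n -/theta; ring.
have nE c' d : (d <= 3 * c')%N -> (c' * l - d)%:R = c'%:R * l%:R - d%:R :> algC.
  by move=> dc; rewrite natrB ?natrM // (leq_trans dc) // mulnC leq_mul2l l_gt2 orbT.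
have l1E : (l - 1)%:R = l%:R - 1 :> algC by rewrite natrB // (ltnW (ltnW l_gt2)).
have mod0 x : (x = 0 %[mod m])%Z <-> (l %| x)%Z && (2 %| x)%Z.
  by rewrite -(eqz_mod0 hl2); split=> /eqP.
have modL x : (x = L %[mod m])%Z <-> (l %| x)%Z && ~~ (2 %| x)%Z.
  by rewrite -(eqz_modl hl2); split=> /eqP.
have modE : (i = j %[mod m])%Z <-> (l %| i - j)%Z && (2 %| i - j)%Z.
  by rewrite -(dvdz_twice_prime hl2) -eqz_mod_dvd; split=> /eqP.
have par0 x : (x = 0 %[mod 2])%Z <-> (2 %| x)%Z.
  by rewrite -{2}(subr0 x) -eqz_mod_dvd; split=> /eqP.
have parE : (i = j %[mod 2])%Z <-> (2 %| i - j)%Z.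
  by rewrite -eqz_mod_dvd; split=> /eqP.
have li_lij : (l %| i)%Z -> (l %| i - j)%Z = (l %| j)%Z by move=> li; rewrite (rpredBl _ li).
have lj_lij : (l %| j)%Z -> (l %| i - j)%Z = (l %| i)%Z by move=> lj; rewrite (rpredBr _ lj).
have table := conj (conj (conj (mod0 i) (mod0 j)) (conj (mod0 (i - j)) modE))
  (conj (conj (conj (modL i) (modL j)) (conj (modL (i - j)) (conj (par0 i) (par0 j))))
    (conj parE (conj li_lij lj_lij))).
split; [|split; [|split; [|split; [|split; [|split]]]]] => H.
- rewrite (P_cyclo ((2 * l - 1) * (2 * l - 2))%N 0%N 0%N 0%N).
    by rewrite /cyclo_poly expr0 mulr1 big1 ?mulr1 // => r _; rewrite !expr0 mulr1.
  rewrite !natrM !nE //; decide_residues i j l m L table H.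
- rewrite (P_cyclo (4 * l - 4)%N 0%N (4 * l - 6)%N 0%N).
    rewrite /cyclo_poly expr0 mulr1; congr (_ * _).
    by apply: eq_bigr => r _; rewrite expr0 mulr1.
  rewrite !nE //; decide_residues i j l m L table H.
- rewrite (P_cyclo (2 * l - 2)%N 0%N (4 * l - 4)%N 0%N).
    rewrite /cyclo_poly expr0 mulr1; congr (_ * _).
    by apply: eq_bigr => r _; rewrite expr0 mulr1.
  rewrite !nE //; decide_residues i j l m L table H.
- rewrite (P_cyclo (2 * (l - 1) ^ 2)%N (2 * l * (l - 1))%N 0%N 0%N).
    by rewrite /cyclo_poly [X in _ * X]big1 ?mulr1 // => r _; rewrite !expr0 mulr1.
  rewrite !natrM !l1E; decide_residues i j l m L table H.
- split.
    rewrite (P_cyclo 0%N (2 * l - 2)%N (2 * l - 2)%N (2 * l - 2)%N).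
      rewrite /cyclo_poly expr0 mul1r; congr (_ * _).
      by apply: eq_bigr => r _; rewrite exprMn.
    rewrite !nE //; decide_residues i j l m L table H.
  apply: (P_eq _ (fun A B => (2 * l - 2)%:R * ((2 * l)%:R * (A && B)%:R - 1))) => [N|].
    under eq_bigr => r _ do
      rewrite -[_ ^+ (2 * l - 2)]mulr1 -(expr0 (1 + (xi ^+ r * theta) *: 'X)).
    apply: has_logder_ext (has_logder_root_prod N (2 * l - 2) 0 theta hxi) => n _.
    by rewrite Gauss_dvd ?coprime2n // andbC mul0r addr0.
  rewrite nE // natrM; decide_residues i j l m L table H.
- rewrite (P_cyclo (2 * l - 2)%N (2 * l - 2)%N (2 * l - 4)%N (2 * l - 2)%N).
    by rewrite /cyclo_poly exprMn.
  rewrite !nE //; decide_residues i j l m L table H.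
rewrite (P_cyclo (l - 1)%N (l - 1)%N (2 * l - 3)%N (2 * l - 1)%N).
  by rewrite /cyclo_poly exprMn.
rewrite !nE // l1E; decide_residues i j l m L table H.
Qed.
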